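(* Let $M^*=\bar U\bar V^\top$ for some pair $(\bar U,\bar V)\in\mathcal M(r,B)$, where $r\ge 1$ and $B>0$. Let $\alpha\in(0,1)$, and let $\pi_{n,\alpha}$ be the fractional posterior built from the low-rank factorization prior with hyperparameters $a,b>0$. Then there is a constant $C_{a,B}$, depending only on $a$ and $B$, such that, setting $$\varepsilon_n = C_{a,B}\,\frac{r(d_1+d_2)\log(nd_1d_2)}{n},$$ for a sufficiently small $b>0$, such as $b=\frac{B^2}{512\,(nd_1d_2)^4K^2\max(d_1,d_2)^2}$, it holds that $$\mathbb P\left[\int D_\alpha(P_M,P_{M^*})\,\pi_{n,\alpha}(\mathrm dM)\le\frac{2(\alpha+1)}{1-\alpha}\,\varepsilon_n\right]\ge 1-\frac{2}{n\varepsilon_n}.$$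
   Context: Model (1-bit matrix completion). Let $f(x)=e^x/(1+e^x)$ and let $\Pi$ be a fixed probability distribution on $[d_1]\times[d_2]$, where $[m]=\{1,\dots,m\}$. For $M\in\mathbb R^{d_1\times d_2}$, $P_M$ denotes the joint distribution of a pair $(\omega,Y)\in([d_1]\times[d_2])\times\{-1,+1\}$ with $\omega\sim\Pi$ and, given $\omega$, $Y=1$ with probability $f(M_\omega)$ and $Y=-1$ with probability $1-f(M_\omega)$. The data $(\omega_1,Y_1),\dots,(\omega_n,Y_n)$ are i.i.d. from $P_{M^*}$ with $M^*\in\mathbb R^{d_1\times d_2}$; $\mathbb E$ and $\mathbb P$ refer to the law of this sample. Fractional posterior. The likelihood is $L_n(M)=\prod_{s=1}^n f(M_{\omega_s})^{\mathbf 1[Y_s=1]}(1-f(M_{\omega_s}))^{\mathbf 1[Y_s=-1]}$. For $\alpha\in(0,1)$ and a prior $\pi$ on matrices, $\pi_{n,\alpha}(\mathrm dM)\propto L_n(M)^\alpha\,\pi(\mathrm dM)$. Low-rank factorization prior. Fix $K\in\{1,\dots,\min(d_1,d_2)\}$. The prior $\pi$ is the law of $M=LR^\top$, $L\in\mathbb R^{d_1\times K}$, $R\in\mathbb R^{d_2\times K}$, where $\gamma_1,\dots,\gamma_K$ are i.i.d. from $\pi^\gamma$ and, given $\gamma=(\gamma_1,\dots,\gamma_K)$, all rows $L_{i,\cdot}$ ($i\in[d_1]$) and $R_{j,\cdot}$ ($j\in[d_2]$) are i.i.d. $\mathcal N(0,\mathrm{diag}(\gamma))$. Here $\pi^\gamma$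 is either the Gamma distribution $\Gamma(a,b)$ (density $\propto x^{a-1}e^{-bx}$ on $x>0$) or the inverse-Gamma distribution $\Gamma^{-1}(a,b)$ (density $\propto x^{-a-1}e^{-b/x}$ on $x>0$), with $a>0$ a fixed constant and $b>0$ a tuning parameter. Class $\mathcal M(r,B)$. For $1\le r\le K$ and $B>0$, $\mathcal M(r,B)$ is the set of pairs $(\bar U,\bar V)$ of matrices of dimensions $d_1\times K$ and $d_2\times K$ with $\|\bar U\|_\infty\le B$, $\|\bar V\|_\infty\le B$ (maximum absolute entry), and $\bar U_{i,\ell}=0$, $\bar V_{j,\ell}=0$ for all $i,j$ whenever $\ell>r$. Rényi divergence. For $\alpha\in(0,1)$, $D_\alpha(Q,R)=\frac1{\alpha-1}\log\int\left(\frac{\mathrm dQ}{\mathrm d\mu}\right)^\alpha\left(\frac{\mathrm dR}{\mathrm d\mu}\right)^{1-\alpha}\mathrm d\mu$ for any $\mu$ dominating $Q$ and $R$. *)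

(* Defs.v *)
From HB Require Import structures.
From mathcomp Require Import all_boot all_order all_algebra.
From mathcomp Require Import all_classical all_reals all_analysis.
From mathcomp Require Import measurable_realfun.

Set Implicit Arguments.
Unset Strict Implicit.
Unset Printing Implicit Defensive.

Import Order.TTheory GRing.Theory Num.Theory.
Import numFieldNormedType.Exports.

Local Open Scope classical_set_scope.
Local Open Scope ring_scope.

Definition measure_mx_display : measure_display -> measure_display.
Proof. exact. Qed.

(* Matrices carry the product sigma-algebra, generated by the coordinate maps;
   for real matrices this is the Borel sigma-algebra. *)
Section measurable_matrix.
Context d (T : measurableType d) (m n : nat).

Definition mx_cylinders : set (set 'M[T]_(m, n)) :=
  [set C | exists (i : 'I_m) (j : 'I_n) (A : set T),
     measurable A /\ C = [set M : 'M[T]_(m, n) | A (M i j)]].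

Let mx_set0 : <<s mx_cylinders >> set0.
Proof. exact: sigma_algebra0. Qed.

Let mx_setC A : <<s mx_cylinders >> A -> <<s mx_cylinders >> (~` A).
Proof. exact: sigma_algebraC. Qed.

Let mx_bigcup (F : (set 'M[T]_(m, n))^nat) :
  (forall i, <<s mx_cylinders >> (F i)) ->
  <<s mx_cylinders >> (\bigcup_i (F i)).
Proof. exact: sigma_algebra_bigcup. Qed.

HB.instance Definition _ := @isMeasurable.Build (measure_mx_display d)
  'M[T]_(m, n) <<s mx_cylinders >> mx_set0 mx_setC mx_bigcup.

End measurable_matrix.

Lemma measurable_coord d (T : measurableType d) (m n : nat) i j :
  measurable_fun setT (fun M : 'M[T]_(m, n) => M i j).
Proof.
move=> _ A mA; rewrite setTI; apply: sub_sigma_algebra.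
by exists i, j, A.
Qed.

Section density_measure.
Local Open Scope ereal_scope.
Context d (T : measurableType d) (R : realType).
Variables (mu : {measure set T -> \bar R}) (f : T -> R).
Hypotheses (mf : measurable_fun setT f) (f0 : forall x, (0 <= f x)%R).

Definition density_measure of measurable_fun setT f
    & (forall x, (0 <= f x)%R) : set T -> \bar R :=
  fun A => \int[mu]_(x in A) (f x)%:E.

Local Notation nu := (density_measure mf f0).

Let nu0 : nu set0 = 0.
Proof. by rewrite /density_measure integral_set0. Qed.

Let nu_ge0 A : 0 <= nu A.
Proof. by apply: integral_ge0 => x _; rewrite lee_fin. Qed.

Let nu_sigma_additive : semi_sigma_additive nu.
Proof.
move=> /= F mF tF mUF; rewrite /density_measure ge0_integral_bigcup//.
- apply: is_cvg_ereal_nneg_natsum_cond => n _ _.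
  by apply: integral_ge0 => x _; rewrite lee_fin.
- by apply/measurable_EFinP; exact: measurable_funTS.
- by move=> x _; rewrite lee_fin.
Qed.

HB.instance Definition _ := isMeasure.Build _ _ _
  (density_measure mf f0) nu0 nu_ge0 nu_sigma_additive.

End density_measure.

Section model.
Context {R : realType}.

Definition logistic (x : R) : R := expR x / (1 + expR x).

Lemma logistic_ge0 x : 0 <= logistic x.
Proof. by rewrite divr_ge0 ?addr_ge0 ?expR_ge0. Qed.

Lemma logistic_le1 x : logistic x <= 1.
Proof.
by rewrite ler_pdivrMr ?mul1r ?lerDr// ltr_pwDl// expR_ge0.
Qed.

Lemma measurable_logistic : measurable_fun setT logistic.
Proof.
apply: continuous_measurable_fun => x; apply: cvgM; first exact: continuous_expR.
apply: cvgV; first by rewrite gt_eqF// ltr_pwDl// expR_ge0.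
by apply: cvgD; [exact: cvg_cst|exact: continuous_expR].
Qed.

Definition is_pmf (T : finType) (p : T -> R) : Prop :=
  (forall z, 0 <= p z) /\ \sum_z p z = 1.

(* An observation (omega, Y); Y = +1 is encoded by true and Y = -1 by false. *)
Definition obs (d1 d2 : nat) : finType := (('I_d1 * 'I_d2) * bool)%type.

Definition lik1 (d1 d2 : nat) (M : 'M[R]_(d1, d2)) (z : obs d1 d2) : R :=
  if z.2 then logistic (M z.1.1 z.1.2) else 1 - logistic (M z.1.1 z.1.2).

(* The probability mass function of P_M. *)
Definition PM (d1 d2 : nat) (Pi : 'I_d1 * 'I_d2 -> R) (M : 'M[R]_(d1, d2))
    (z : obs d1 d2) : R := Pi z.1 * lik1 M z.

(* A sample of n independent T-valued variables with common mass function p. *)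
Definition iid_sample d (Omega : measurableType d) (P : probability Omega R)
    (n : nat) (T : finType) (X : 'I_n -> Omega -> T) (p : T -> R) : Prop :=
  [/\ forall s z, measurable [set t | X s t = z],
      forall s z, P [set t | X s t = z] = (p z)%:E
    & forall z : 'I_n -> T, P [set t | forall s, X s t = z s] =
        (\prod_(s < n) P [set t | X s t = z s])%E].

Definition likelihood (n d1 d2 : nat) (x : 'I_n -> obs d1 d2)
    (M : 'M[R]_(d1, d2)) : R := \prod_(s < n) lik1 M (x s).

(* The Renyi divergence for mass functions on a finite set: the dominating
   measure is the counting measure.  The sum is positive as soon as q and r
   have a common point in their supports, as for any two P_M. *)
Definition renyi (T : finType) (alpha : R) (q r : T -> R) : R :=
  (alpha - 1)^-1 * ln (\sum_z q z `^ alpha * r z `^ (1 - alpha)).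

Lemma measurable_fractional_likelihood (n d1 d2 : nat) (alpha : R)
    (x : 'I_n -> obs d1 d2) :
  measurable_fun setT
    (fun M : 'M[R]_(d1, d2) => likelihood x M `^ alpha).
Proof.
apply: (measurableT_comp (measurable_powR _)).
apply: measurable_prod => s _; rewrite /lik1.
have mL : measurable_fun setT
    (fun M : 'M[R]_(d1, d2) => logistic (M (x s).1.1 (x s).1.2)).
  by apply: (measurableT_comp measurable_logistic); exact: measurable_coord.
by case: (x s).2 => //; exact: measurable_funB.
Qed.

Lemma fractional_likelihood_ge0 (n d1 d2 : nat) (alpha : R)
    (x : 'I_n -> obs d1 d2) (M : 'M[R]_(d1, d2)) :
  0 <= likelihood x M `^ alpha.
Proof. exact: powR_ge0. Qed.

(* The normalizing constant lies in ]0, 1], so the default value (second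
   argument) of mnormalize is never used. *)
Definition fractional_posterior (n d1 d2 : nat) (alpha : R)
    (pi : probability 'M[R]_(d1, d2) R) (x : 'I_n -> obs d1 d2) :
    probability 'M[R]_(d1, d2) R :=
  mnormalize
    (density_measure pi (@measurable_fractional_likelihood n d1 d2 alpha x)
       (fractional_likelihood_ge0 alpha x)) pi.

Variant hyperfamily := GammaLaw | InvGammaLaw.

Definition hyper_density (F : hyperfamily) (a b x : R) : R :=
  if 0 < x then
    match F with
    | GammaLaw => x `^ (a - 1) * expR (- (b * x))
    | InvGammaLaw => x `^ (- a - 1) * expR (- (b / x))
    end
  else 0.

Lemma hyper_density_ge0 F a b x : 0 <= hyper_density F a b x.
Proof.
rewrite /hyper_density; case: ifP => // _.
by case: F; rewrite mulr_ge0 ?powR_ge0 ?expR_ge0.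
Qed.

Lemma measurable_hyper_density F a b :
  measurable_fun [set: measurableTypeR R] (hyper_density F a b).
Proof.
have mg c : measurable_fun [set: measurableTypeR R]
    (fun x => x `^ c : measurableTypeR R) by exact: measurable_powR.
have mexp (g : measurableTypeR R -> R) : measurable_fun setT g ->
    measurable_fun [set: measurableTypeR R] (fun x => expR (- (b * g x))).
  move=> mg0; apply: (measurableT_comp (@measurable_expR R)).
  by apply: measurableT_comp => //; exact: measurable_funM.
have -> : hyper_density F a b = fun x => if 0 < x then
    match F with
    | GammaLaw => x `^ (a - 1) * expR (- (b * x))
    | InvGammaLaw => x `^ (- a - 1) * expR (- (b * x `^ (- 1)))
    end else 0.
  apply/funext => x; rewrite /hyper_density; case: ifP => // /ltW x0.
  by case: F; rewrite // powR_inv1.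
apply: measurable_fun_ifT => //=.
  by apply: measurable_fun_ltr.
by case: F; apply: measurable_funM; rewrite //; exact: mexp.
Qed.

(* For a, b > 0 the normalizing constant is positive and finite, so the
   default value \d_0 of mnormalize is not used. *)
Definition hyperprior (F : hyperfamily) (a b : R) :
    probability (measurableTypeR R) R :=
  mnormalize
    (density_measure (@lebesgue_measure R) (@measurable_hyper_density F a b)
       (hyper_density_ge0 F a b))
    (\d_(0 : measurableTypeR R)).

(* The value of N(0, diag(gamma)) on the box \prod_k S k of R^K. *)
Definition normal_diag (K : nat) (gamma : 'I_K -> R) (S : 'I_K -> set R) :
    \bar R := (\prod_(k < K) normal_prob 0 (Num.sqrt (gamma k)) (S k))%E.

(* The joint law of the hyperparameters and the two factors: the gamma_k are
   i.i.d. from the hyperprior and, conditionally on gamma, the rows of L and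
   Rm are i.i.d. from N(0, diag(gamma)).  Both laws are given on the
   measurable boxes, which determine them. *)
Definition factor_hierarchy d (Omega : measurableType d)
    (Q : probability Omega R) (d1 d2 K : nat)
    (pigamma : probability (measurableTypeR R) R)
    (gamma : 'I_K -> {RV Q >-> R})
    (L : {RV Q >-> 'M[R]_(d1, K)}) (Rm : {RV Q >-> 'M[R]_(d2, K)}) : Prop :=
  (forall A : 'I_K -> set R, (forall k, measurable (A k)) ->
     Q [set t | forall k, A k (gamma k t)] = (\prod_(k < K) pigamma (A k))%E)
  /\
  (forall (A : 'I_K -> set R)
      (SL : 'I_d1 -> 'I_K -> set R) (SR : 'I_d2 -> 'I_K -> set R),
     (forall k, measurable (A k)) ->
     (forall i k, measurable (SL i k)) -> (forall j k, measurable (SR j k)) ->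
     Q [set t | [/\ forall k, A k (gamma k t),
                    forall i k, SL i k (L t i k)
                  & forall j k, SR j k (Rm t j k)]] =
     (\int[Q]_(t in [set t | forall k, A k (gamma k t)])
        ((\prod_(i < d1) normal_diag (fun k => gamma k t) (SL i)) *
         (\prod_(j < d2) normal_diag (fun k => gamma k t) (SR j))))%E).

(* pi is the law of L *m Rm^T for some such hierarchy; this determines pi. *)
Definition is_factorization_prior (d1 d2 K : nat)
    (pigamma : probability (measurableTypeR R) R)
    (pi : probability 'M[R]_(d1, d2) R) : Prop :=
  exists (d : measure_display) (Omega : measurableType d)
    (Q : probability Omega R) (gamma : 'I_K -> {RV Q >-> R})
    (L : {RV Q >-> 'M[R]_(d1, K)}) (Rm : {RV Q >-> 'M[R]_(d2, K)}),
    factor_hierarchy pigamma gamma L Rm /\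
    forall A : set 'M[R]_(d1, d2), measurable A ->
      pi A = Q [set t | A (L t *m (Rm t)^T)].

(* Columns are numbered from 0, so the columns of index > r in 1..K are those
   of index >= r here. *)
Definition low_rank_class (d1 d2 K r : nat) (B : R)
    (U : 'M[R]_(d1, K)) (V : 'M[R]_(d2, K)) : Prop :=
  [/\ forall i l, `|U i l| <= B, forall j l, `|V j l| <= B,
      forall i (l : 'I_K), (r <= l)%N -> U i l = 0
    & forall j (l : 'I_K), (r <= l)%N -> V j l = 0].

End model.

(* Main.v *)
(* Write h(M) = sum_z P_M(z)^alpha P_{M*}(z)^(1 - alpha), so that
   D_alpha(P_M, P_{M*}) = ln h(M) / (alpha - 1), and T = n eps.

   The integral over the prior of (L_n(M) / L_n(M* ))^alpha h(M)^-n has mean 1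
   under the sample, hence is at most exp ((1 + alpha) T) with probability at
   least 1 - exp (- (1 + alpha) T) >= 1 - 1 / T.  As ln f and ln (1 - f) are
   1-Lipschitz, the likelihood ratio is at least exp (- n delta) on the ball of
   radius delta around M* for the maximum norm; this deterministic bound replaces
   the Chebyshev argument of the general theory.  If n delta <= T and the ball has
   prior mass at least exp (- T), the normalizing constant of the posterior,
   divided by L_n(M* )^alpha, is therefore at least exp (- (1 + alpha) T), and
   Jensen's inequality bounds the posterior mean of n (1 - alpha) D_alpha by
   2 (1 + alpha) T.

   For delta = B^2 / n, the ball contains the L R^T whose factors are within
   tau = B / (8 N) of U and V entrywise, where N = n d1 d2.  Restrict gamma_k to a
   dyadic interval, around B^2 for the r columns of U and V that may be nonzero
   and around tau^2 / K for the others.  Each of these K intervals has hyperprior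
   mass at least a power of 1 / N, so has each entry of the first r columns, and
   each of the other entries stays within tau with probability 1 - 1 / (2 K).  The
   product of all these masses is at least N^(- q r (d1 + d2)), with q depending
   on a and B only. *)

Require Import Defs.
From HB Require Import structures.
From mathcomp Require Import all_boot all_order all_algebra.
From mathcomp Require Import all_classical all_reals all_analysis.
From mathcomp Require Import measurable_realfun.
From mathcomp Require Import ring lra zify.

Set Implicit Arguments.
Unset Strict Implicit.
Unset Printing Implicit Defensive.

Import Order.TTheory GRing.Theory Num.Theory.
Import numFieldNormedType.Exports.

Local Open Scope classical_set_scope.
Local Open Scope ring_scope.

(** * Contraction of the fractional posterior *)

Section density_measure_integral.
Local Open Scope ereal_scope.
Context d (T : measurableType d) (R : realType).
Variables (mu : {measure set T -> \bar R}) (f : T -> R).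
Hypotheses (mf : measurable_fun setT f) (f0 : forall x, (0 <= f x)%R).
Local Notation nu := (density_measure mu mf f0).

Import HBNNSimple.

Let integral_density_measure_nnsfun (h : {nnsfun T >-> R}) :
  \int[nu]_x (h x)%:E = \int[mu]_x ((h x)%:E * (f x)%:E).
Proof.
rewrite integralT_nnsfun sintegralE.
under [RHS]eq_integral => x _.
  rewrite fimfunE -fsumEFin// ge0_mule_fsuml; last first.
    by move=> y; exact: nnfun_muleindic_ge0.
  over.
rewrite ge0_integral_fsum//; first last.
- by move=> r x _; rewrite mule_ge0 ?nnfun_muleindic_ge0// lee_fin.
- move=> r; apply: emeasurable_funM; last exact/measurable_EFinP.
  by apply/measurable_EFinP; exact: measurable_funM.
apply: eq_fsbigr => r; rewrite inE => -[t _ <-].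
under eq_integral do rewrite EFinM -muleA.
rewrite ge0_integralZl//.
- rewrite /density_measure/= [X in _ * X]integral_mkcond; congr (_ * _).
  by apply: eq_integral => x _; rewrite epatch_indic muleC.
- apply: emeasurable_funM; last exact/measurable_EFinP.
  by apply/measurable_EFinP; exact: measurable_indic.
- by move=> x _; rewrite mule_ge0 ?lee_fin.
- by rewrite lee_fin.
Qed.

(** Simple functions are handled by linearity; monotone convergence along [nnsfun_approx], applied
    on both sides, gives the rest. *)
Lemma integral_density_measure (g : T -> \bar R) :
  (forall x, 0 <= g x) -> measurable_fun setT g ->
  \int[nu]_x g x = \int[mu]_x (g x * (f x)%:E).
Proof.
move=> g0 mg; pose h := nnsfun_approx measurableT mg.
have hg x : (h n x)%:E @[n --> \oo] --> g x.
  by apply: (@cvg_nnsfun_approx _ _ _ _ measurableT g mg) => // y _; exact: g0.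
have mh n : measurable_fun setT (fun x => (h n x)%:E) by exact/measurable_EFinP.
have hnd x : {homo (fun n => (h n x)%:E) : m n / (m <= n)%N >-> m <= n}.
  by move=> m n mn; rewrite lee_fin; exact/lefP/nd_nnsfun_approx.
have -> : \int[nu]_x g x = limn (fun n => \int[nu]_x (h n x)%:E).
  rewrite -monotone_convergence//; last by move=> n x _; rewrite lee_fin.
  by apply: eq_integral => x _; apply/esym/cvg_lim => //; exact: hg.
under eq_fun do rewrite integral_density_measure_nnsfun.
rewrite -monotone_convergence//.
- apply: eq_integral => x _; apply: cvg_lim => //.
  by apply: cvgeZr; [|exact: hg].
- by move=> n; apply: emeasurable_funM; [exact: mh|exact/measurable_EFinP].
- by move=> n x _; rewrite mule_ge0 ?lee_fin.
- by move=> x _ m n mn; rewrite lee_wpmul2r ?lee_fin//; exact: hnd.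
Qed.

End density_measure_integral.

(** A mass that is neither zero nor infinite keeps [mnormalize] away from its default [P], leaving a
    mere rescaling of [mu]. *)
Lemma ge0_integral_mnormalize d (T : measurableType d) (R : realType)
    (mu : {measure set T -> \bar R}) (P : probability T R) (g : T -> \bar R) :
  (mu setT != 0)%E -> (mu setT != +oo)%E ->
  (forall x, (0 <= g x)%E) -> measurable_fun setT g ->
  (\int[mnormalize mu P]_x g x = (fine (mu setT))^-1%:E * \int[mu]_x g x)%E.
Proof.
move=> mu0 muy g0 mg.
have k0 : 0 <= (fine (mu setT))^-1 by rewrite invr_ge0 fine_ge0.
rewrite [LHS](eq_measure_integral (mscale (NngNum k0) mu)).
  by rewrite ge0_integral_mscale.
move=> A mA _; rewrite /= /mnormalize/=; case: ifPn.
  by rewrite (negbTE mu0) (negbTE muy).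
by move=> _; rewrite /mscale/= muleC.
Qed.

Lemma integral_cst_probability d (T : measurableType d) (R : realType)
    (P : probability T R) (r : \bar R) : (\int[P]_x r = r)%E.
Proof.
rewrite integral_cst// -[RHS]mule1; congr (_ * _)%E; exact: probability_setT.
Qed.

Lemma powR_prod {R : realType} (I : Type) (s : seq I) (P : pred I)
    (f : I -> R) (r : R) : (forall i, P i -> 0 <= f i) ->
  (\prod_(i <- s | P i) f i) `^ r = \prod_(i <- s | P i) f i `^ r.
Proof.
move=> f0; suff [] : 0 <= \prod_(i <- s | P i) f i /\
  (\prod_(i <- s | P i) f i) `^ r = \prod_(i <- s | P i) f i `^ r by [].
elim/big_rec2 : _ => [|i y x Pi [x0 <-]]; first by rewrite powR1.
by rewrite powRM ?f0// mulr_ge0 ?f0.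
Qed.

(** * Logistic likelihood and affinity *)

Section likelihood.
Context {R : realType}.
Implicit Types (x y delta alpha : R).

Lemma logistic_gt0 x : 0 < logistic x.
Proof. by rewrite divr_gt0 ?addr_gt0 ?expR_gt0. Qed.

Lemma onem_logistic x : 1 - logistic x = (1 + expR x)^-1.
Proof.
rewrite /logistic; have : 1 + expR x != 0 by rewrite gt_eqF ?addr_gt0 ?expR_gt0.
by move=> ?; field.
Qed.

(** Multiplicative form of the 1-Lipschitz property of ln f. Once denominators are cleared, the
    exponentials compare term by term. *)
Lemma ge_logistic delta x y : `|x - y| <= delta ->
  expR (- delta) * logistic y <= logistic x.
Proof.
move=> xy; have d0 : 0 <= delta by exact: le_trans xy.
rewrite /logistic mulrA ler_pdivrMr ?addr_gt0 ?expR_gt0//.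
rewrite mulrAC ler_pdivlMr ?addr_gt0 ?expR_gt0//.
have yx : y - delta <= x by move: xy; rewrite ler_norml; lra.
rewrite !mulrDr !mulr1 -!expRD lerD// ler_expR; lra.
Qed.

Lemma ge_onem_logistic delta x y : `|x - y| <= delta ->
  expR (- delta) * (1 - logistic y) <= 1 - logistic x.
Proof.
move=> xy; have d0 : 0 <= delta by exact: le_trans xy.
rewrite !onem_logistic ler_pdivrMr ?addr_gt0 ?expR_gt0//.
rewrite mulrC ler_pdivlMr ?addr_gt0 ?expR_gt0//.
have yx : x - delta <= y by move: xy; rewrite ler_norml; lra.
by rewrite mulrDr mulr1 -expRD lerD// ?ler_expR ?expR_le1; lra.
Qed.

Variables d1 d2 : nat.
Implicit Types (M : 'M[R]_(d1, d2)) (z : obs d1 d2) (Pi : 'I_d1 * 'I_d2 -> R).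

Lemma lik1_gt0 M z : 0 < lik1 M z.
Proof.
rewrite /lik1; case: ifP => _; first exact: logistic_gt0.
by rewrite onem_logistic invr_gt0 addr_gt0 ?expR_gt0.
Qed.

Lemma lik1_le1 M z : lik1 M z <= 1.
Proof.
rewrite /lik1; case: ifP => _; first exact: logistic_le1.
by have := logistic_ge0 (M z.1.1 z.1.2); lra.
Qed.

Lemma ge_lik1 delta M M' z : (forall i j, `|M i j - M' i j| <= delta) ->
  expR (- delta) * lik1 M' z <= lik1 M z.
Proof.
move=> MM'; rewrite /lik1; case: ifP => _.
  exact: ge_logistic.
exact: ge_onem_logistic.
Qed.

Lemma likelihood_gt0 n (x : 'I_n -> obs d1 d2) M : 0 < likelihood x M.
Proof. by apply: prodr_gt0 => s _; exact: lik1_gt0. Qed.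

Lemma likelihood_le1 n (x : 'I_n -> obs d1 d2) M : likelihood x M <= 1.
Proof. by apply: prodr_ile1 => s _; rewrite ltW ?lik1_gt0 ?lik1_le1. Qed.

Lemma ge_likelihood n (x : 'I_n -> obs d1 d2) delta M M' :
  (forall i j, `|M i j - M' i j| <= delta) ->
  expR (- (n%:R * delta)) * likelihood x M' <= likelihood x M.
Proof.
move=> MM'; rewrite -mulrN expRM_natl -[X in _ ^+ X]card_ord -prodr_const -big_split/=.
apply: ler_prod => s _; rewrite ge_lik1// andbT.
by rewrite mulr_ge0 ?expR_ge0// ltW// lik1_gt0.
Qed.

Lemma PM_ge0 Pi M z : is_pmf Pi -> 0 <= PM Pi M z.
Proof. by case=> Pi0 _; rewrite mulr_ge0// ltW// lik1_gt0. Qed.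

Lemma measurable_lik1 z : measurable_fun setT (fun M => lik1 M z).
Proof.
rewrite /lik1.
have mL : measurable_fun setT (fun M => logistic (M z.1.1 z.1.2)).
  by apply: (measurableT_comp measurable_logistic); exact: measurable_coord.
by case: z.2 => //; exact: measurable_funB.
Qed.

(** The h(M) of the overview, with [M'] as the reference matrix. *)
Definition affinity alpha Pi M M' : R :=
  \sum_z PM Pi M z `^ alpha * PM Pi M' z `^ (1 - alpha).

(** Exhibits the affinity as the mean, under the law of [M'], of a power of the likelihood ratio;
    the sampling distribution cancels from the ratio. *)
Lemma affinityE alpha Pi M M' : is_pmf Pi ->
  affinity alpha Pi M M' =
  \sum_z PM Pi M' z * (lik1 M z `^ alpha / lik1 M' z `^ alpha).
Proof.
move=> [Pi0 _]; apply: eq_bigr => z _; rewrite /PM.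
have l0 := ltW (lik1_gt0 M z); have l'0 := lik1_gt0 M' z.
rewrite !powRM ?(ltW l'0)//.
have -> : lik1 M' z `^ (1 - alpha) = lik1 M' z / lik1 M' z `^ alpha.
  by rewrite powRB ?powRr1 ?(lt0r_neq0 l'0) ?implybT// ltW.
have PiE : Pi z.1 `^ alpha * Pi z.1 `^ (1 - alpha) = Pi z.1.
  (* Powers at 0 are delicate, since 0 to the power 0 is 1; for [alpha] = 0 it is the other factor
     that vanishes. *)
  have [->|Piz] := eqVneq (Pi z.1) 0.
    have [->|a0] := eqVneq alpha 0; last by rewrite powR0// !mul0r.
    by rewrite subr0 powRr1 ?mulr0.
  by rewrite -powRD ?Piz ?implybT// addrC subrK powRr1.
rewrite -[X in _ = X * _ * _]PiE; ring.
Qed.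

(** Masses summing to 1 charge some entry, and logistic likelihoods never vanish. The logarithm in
    the divergence is thus taken at a positive number. *)
Lemma affinity_gt0 alpha Pi M M' : is_pmf Pi -> 0 < affinity alpha Pi M M'.
Proof.
move=> Pipmf; rewrite affinityE//.
have [w w0] : exists w, 0 < Pi w.
  apply: contrapT => /forallNP Pi_le0; have [Pi0 Pi1] := Pipmf.
  move: Pi1; rewrite big1 => [/esym/eqP|w _]; first by rewrite oner_eq0.
  apply/eqP; rewrite eq_le Pi0 andbT leNgt; apply/negP; exact: Pi_le0.
rewrite (bigD1 (w, true))//= ltr_pwDl//.
  by rewrite mulr_gt0 ?divr_gt0 ?powR_gt0 ?lik1_gt0// mulr_gt0 ?lik1_gt0.
by apply: sumr_ge0 => z _; rewrite mulr_ge0 ?PM_ge0// divr_ge0 ?powR_ge0.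
Qed.

Lemma renyiE alpha Pi M M' :
  renyi alpha (PM Pi M) (PM Pi M') =
  (alpha - 1)^-1 * ln (affinity alpha Pi M M').
Proof. by []. Qed.

Lemma measurable_affinity alpha Pi M' :
  measurable_fun setT (fun M => affinity alpha Pi M M').
Proof.
rewrite /affinity; apply: measurable_sum => z.
apply: measurable_funM => //; apply: (measurableT_comp (measurable_powR _)).
by apply: measurable_funM => //; exact: measurable_lik1.
Qed.

(** Tensorization: the summand is a product over the observations, so the sum over samples is a
    power of the one-observation sum of [affinityE]. *)
Lemma sum_likelihood_ratio n alpha Pi M M' : is_pmf Pi ->
  \sum_(x : {ffun 'I_n -> obs d1 d2})
    (\prod_(s < n) PM Pi M' (x s)) *
      (likelihood x M `^ alpha / likelihood x M' `^ alpha) =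
  affinity alpha Pi M M' ^+ n.
Proof.
move=> Pipmf; rewrite affinityE// -[X in _ ^+ X]card_ord -prodr_const.
rewrite (bigA_distr_bigA (fun _ z => _)).
apply: eq_bigr => x _; rewrite /likelihood.
have lik0 (N : 'M[R]_(d1, d2)) z : 0 <= lik1 N z by rewrite ltW ?lik1_gt0.
rewrite !powR_prod// -prodf_div -big_split/=.
by apply: eq_bigr.
Qed.

End likelihood.
(** The sample takes finitely many values, so an arbitrary [G] yields a finite disjoint union of
    events that fix all observations; independence factorizes the probability of each. *)
Lemma iid_sample_event d (Omega : measurableType d) (R : realType)
    (P : probability Omega R) n (T : finType) (X : 'I_n -> Omega -> T)
    (p : T -> R) (G : set ('I_n -> T)) : iid_sample P X p ->
  measurable [set t | G (X ^~ t)] /\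
  P [set t | G (X ^~ t)] =
    (\sum_(x : {ffun 'I_n -> T} | `[< G x >]) \prod_(s < n) p (x s))%:E.
Proof.
move=> [mX PX indX].
pose A (x : {ffun 'I_n -> T}) := [set t | forall s, X s t = x s].
have mA x : measurable (A x).
  rewrite (_ : A x = \bigcap_(s in [set: 'I_n]) [set t | X s t = x s]).
    exact: fin_bigcap_measurable.
  by apply/seteqP; split => t /= At s; [move=> _; exact: At|exact: At].
(* Empty pieces outside [G] let the union run over all finite functions. *)
pose B (x : {ffun 'I_n -> T}) := if `[< G x >] then A x else set0.
have mB x : measurable (B x) by rewrite /B; case: ifP.
have BE : [set t | G (X ^~ t)] = \bigcup_(x in [set: {ffun 'I_n -> T}]) B x.
  have fE t : [ffun s => X s t] = X ^~ t :> (_ -> _).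
    by apply/funext => s; rewrite ffunE.
  apply/seteqP; split => t /=.
    move=> Gt; exists [ffun s => X s t] => //; rewrite /B fE asboolT// => s.
    by rewrite ffunE.
  move=> [x _]; rewrite /B; case: asboolP => // Gx At.
  by rewrite (_ : X ^~ t = x)//; apply/funext => s; rewrite At.
split; first by rewrite BE; exact: fin_bigcup_measurable.
rewrite BE measure_fin_bigcup//=; last first.
  move=> x y _ _ [t []]; rewrite /B; case: ifP => // _ Ax; case: ifP => // _ Ay.
  by apply/ffunP => s; rewrite -Ax Ay.
rewrite (_ : [set: _] = [set` index_enum {ffun 'I_n -> T}]); last first.
  by apply/seteqP; split => // x _ /=; rewrite mem_index_enum.
rewrite -fsbig_seq ?index_enum_uniq// -sumEFin [RHS]big_mkcond/=.
apply: eq_bigr => x _.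
rewrite /B; case: ifP => _; last by rewrite measure0.
by rewrite /A indX -prodEFin; apply: eq_bigr => s _; rewrite PX.
Qed.

Lemma iid_sample_ge d (Omega : measurableType d) (R : realType)
    (P : probability Omega R) n (T : finType) (X : 'I_n -> Omega -> T)
    (p : T -> R) (G : set ('I_n -> T)) (c : R) : iid_sample P X p ->
  \sum_(x : {ffun 'I_n -> T} | `[< ~ G x >]) \prod_(s < n) p (x s) <= c ->
  (1 - c%:E <= P [set t | G (X ^~ t)])%E.
Proof.
move=> Xiid Gc; have [mG PG] := iid_sample_event (~` G) Xiid.
rewrite (_ : [set t | G (X ^~ t)] = ~` [set t | (~` G) (X ^~ t)]).
  by rewrite probability_setC// leeB// PG lee_fin.
by apply/seteqP; split => t /= Gt; [exact|exact: contrapT].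
Qed.

Section entrywise_ball.
Context {R : realType} (d1 d2 : nat).
Variables (M0 : 'M[R]_(d1, d2)) (delta : R).

Definition entrywise_ball : set 'M[R]_(d1, d2) :=
  [set M | forall i j, `|M i j - M0 i j| <= delta].

Lemma measurable_entrywise_ball : measurable entrywise_ball.
Proof.
have -> : entrywise_ball =
    \bigcap_(i in [set: 'I_d1]) \bigcap_(j in [set: 'I_d2])
      [set M | M i j \in `[M0 i j - delta, M0 i j + delta]].
  apply/seteqP; split => M /= Md i => [_ j _ /=|j].
    by have := Md i j; rewrite in_itv/= ler_distl.
  by have := Md i I j I; rewrite /= in_itv/= ler_distl.
apply: fin_bigcap_measurable => // i _; apply: fin_bigcap_measurable => // j _.
rewrite -[X in measurable X]setTI.
exact: (measurable_coord i j measurableT (measurable_itv _)).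
Qed.

End entrywise_ball.

(** * From prior mass near the truth to posterior contraction *)

Section fractional_posterior.
Context {R : realType} (d1 d2 n : nat).
Variables (alpha : R) (Pi : 'I_d1 * 'I_d2 -> R).
Variables (prior : probability 'M[R]_(d1, d2) R) (M0 : 'M[R]_(d1, d2)).
Hypotheses (alpha_gt0 : 0 < alpha) (alpha_lt1 : alpha < 1).
Hypotheses (Pi_pmf : is_pmf Pi) (n_gt0 : (0 < n)%N).
Implicit Types (x : 'I_n -> obs d1 d2) (M : 'M[R]_(d1, d2)) (T delta : R).

Let lik x M := likelihood x M `^ alpha.

Let mlik x : measurable_fun setT (lik x).
Proof. exact: measurable_fractional_likelihood. Qed.

Let lik0 x M : 0 <= lik x M.
Proof. exact: powR_ge0. Qed.

Let lik_gt0 x M : 0 < lik x M.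
Proof. by rewrite powR_gt0// likelihood_gt0. Qed.

(** The normalizing constant of [fractional_posterior]. *)
Definition evidence x : \bar R := (\int[prior]_M (likelihood x M `^ alpha)%:E)%E.

Lemma evidence_le1 x : (evidence x <= 1)%E.
Proof.
rewrite -(probability_setT prior) -[leRHS]mul1e -integral_cst//.
apply: ge0_le_integral => //=.
- by move=> M _; rewrite lee_fin lik0.
- by apply/measurable_EFinP; exact: mlik.
- move=> M _; rewrite lee_fin -[leRHS](congr1 (fun f => f alpha) (@powR1 R)).
  apply: ge0_ler_powR; rewrite ?nnegrE//.
  + exact: ltW.
  + exact/ltW/likelihood_gt0.
  + exact: likelihood_le1.
Qed.

(** Restricting the integral to the ball costs exp(- T) through its prior mass, and exp(- alpha T)
    through the likelihood ratio there. *)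
Lemma evidence_ge T delta x : n%:R * delta <= T ->
  ((expR (- T))%:E <= prior (entrywise_ball M0 delta))%E ->
  ((expR (- ((1 + alpha) * T)) * lik x M0)%:E <= evidence x)%E.
Proof.
move=> ndT priorT.
apply: (@le_trans _ _ (\int[prior]_(M in entrywise_ball M0 delta)
    (expR (- (alpha * T)) * lik x M0)%:E)%E).
  rewrite integral_cst//; last exact: measurable_entrywise_ball.
  apply: (@le_trans _ _ ((expR (- (alpha * T)) * lik x M0)%:E * (expR (- T))%:E)%E).
    by rewrite -EFinM lee_fin mulrAC -expRD le_eqVlt; apply/orP; left;
      apply/eqP; congr (expR _ * _); ring.
  by rewrite lee_wpmul2l// lee_fin mulr_ge0 ?expR_ge0.
apply: (@le_trans _ _ (\int[prior]_(M in entrywise_ball M0 delta) (lik x M)%:E)%E).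
  apply: ge0_le_integral => //=; first exact: measurable_entrywise_ball.
  - by move=> M _; rewrite lee_fin mulr_ge0 ?expR_ge0.
  - by apply/measurable_EFinP; apply: measurable_funTS; exact: mlik.
  - move=> M Md; rewrite lee_fin /lik.
    have L0 M' : 0 <= likelihood x M' by exact/ltW/likelihood_gt0.
    rewrite (mulrC alpha) -mulNr expRM -powRM ?expR_ge0//.
    apply: ge0_ler_powR; rewrite ?nnegrE ?mulr_ge0 ?expR_ge0//; first exact: ltW.
    apply: le_trans (ge_likelihood x Md).
    by rewrite ler_wpM2r// ler_expR lerN2.
apply: ge0_subset_integral => //.
- exact: measurable_entrywise_ball.
- by apply/measurable_EFinP; exact: mlik.
- by move=> M _; rewrite lee_fin lik0.
Qed.

Lemma evidence_fin_num x : evidence x \is a fin_num.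
Proof.
rewrite ge0_fin_numE ?(le_lt_trans (evidence_le1 x)) ?ltry//.
by apply: integral_ge0 => M _; rewrite lee_fin lik0.
Qed.

Lemma ge0_integral_fractional_posterior x (g : 'M[R]_(d1, d2) -> \bar R) :
  (0 < evidence x)%E -> (forall M, 0 <= g M)%E -> measurable_fun setT g ->
  (\int[fractional_posterior alpha prior x]_M g M =
   (fine (evidence x))^-1%:E *
     \int[prior]_M (g M * (likelihood x M `^ alpha)%:E))%E.
Proof.
move=> ev0 g0 mg; rewrite ge0_integral_mnormalize//.
- by rewrite integral_density_measure.
- by rewrite gt_eqF.
- by rewrite lt_eqF// (le_lt_trans (evidence_le1 x)) ?ltry.
Qed.

(** The exponential of n (1 - alpha) times the divergence, as [expR_renyi] shows. *)
Let E M : R := (affinity alpha Pi M M0 ^+ n)^-1.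

Let E_gt0 M : 0 < E M.
Proof. by rewrite invr_gt0 exprn_gt0// affinity_gt0. Qed.

Let mE : measurable_fun setT E.
Proof.
have -> : E = (fun M => affinity alpha Pi M M0 `^ (- n%:R)).
  by apply/funext => M; rewrite powR_invn// ltW// affinity_gt0.
apply: (measurableT_comp (measurable_powR _)); exact: measurable_affinity.
Qed.

Let k : R := n%:R * (1 - alpha).

Let k_gt0 : 0 < k.
Proof. by rewrite mulr_gt0 ?ltr0n// subr_gt0. Qed.

Let expR_renyi M : expR (k * renyi alpha (PM Pi M) (PM Pi M0)) = E M.
Proof.
have h0 := affinity_gt0 alpha M M0 Pi_pmf.
rewrite renyiE /k /E -[in RHS](lnK (x := affinity alpha Pi M M0))//.
rewrite -expRM_natl -expRN; congr expR.
have : alpha - 1 != 0 by rewrite subr_eq0 lt_eqF.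
by move=> ?; field.
Qed.

(* Jensen's inequality for exp, in the form y <= exp (y - c) + c - 1. *)
Lemma posterior_renyi_le c x : 1 <= c -> (0 < evidence x)%E ->
  (\int[prior]_M ((affinity alpha Pi M M0 ^+ n)^-1 * likelihood x M `^ alpha)%:E
    <= (expR c)%:E * evidence x)%E ->
  (\int[fractional_posterior alpha prior x]_M
     (renyi alpha (PM Pi M) (PM Pi M0))%:E <= (c / (n%:R * (1 - alpha)))%:E)%E.
Proof.
move=> c1 ev0 WZ; rewrite -/k.
move: (fractional_posterior alpha prior x)
  (fun g => @ge0_integral_fractional_posterior x g ev0) => post postE.
set D := fun M => renyi alpha (PM Pi M) (PM Pi M0).
have mD : measurable_fun setT D.
  apply: measurable_funM => //; apply: (measurableT_comp (@measurable_ln R)).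
  exact: measurable_affinity.
pose g M : R := (expR (- c) * E M).
have g0 M : 0 <= g M by rewrite mulr_ge0 ?expR_ge0// ltW.
have mg : measurable_fun setT g by exact: measurable_funM.
have gD M : D M <= k^-1 * (g M + (c - 1)).
  rewrite mulrC ler_pdivlMr// mulrC.
  rewrite /g -expR_renyi -expRD.
  by have := expR_ge1Dx (- c + k * renyi alpha (PM Pi M) (PM Pi M0)); rewrite /D; lra.
have ki0 : 0 <= k^-1 by rewrite invr_ge0 ltW.
have c10 : 0 <= c - 1 by rewrite subr_ge0.
have gc0 M : 0 <= k^-1 * (g M + (c - 1)) by rewrite mulr_ge0// addr_ge0.
(* The majorant in [gD] is nonnegative because [c] is at least 1, so it also dominates the positive
   part of [D]. *)
rewrite integralE; apply: (@le_trans _ _ (\int[post]_M (fun M => (D M)%:E)^\+ M)%E).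
  by rewrite geeDl// oppe_le0 integral_ge0.
apply: (@le_trans _ _ (\int[post]_M (k^-1 * (g M + (c - 1)))%:E)%E).
  apply: ge0_le_integral => //=.
  - by apply: measurable_funepos; exact/measurable_EFinP.
  - by apply/measurable_EFinP; apply: measurable_funM => //; exact: measurable_funD.
  - by move=> M _; rewrite funeposE ge_max !lee_fin gD gc0.
under eq_integral do rewrite EFinM.
rewrite ge0_integralZl//=; first last.
- by move=> M _; rewrite lee_fin addr_ge0.
- by apply/measurable_EFinP; exact: measurable_funD.
rewrite mulrC EFinM lee_wpmul2l ?lee_fin//.
under eq_integral do rewrite EFinD.
rewrite ge0_integralD//=; first last.
- exact/measurable_EFinP.
- by move=> M _; rewrite lee_fin.
rewrite integral_cst_probability.
(* The hypothesis on the prior integral makes the posterior mean of [g] at most 1, whence the total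
   1 + (c - 1) = c. *)
apply: (@le_trans _ _ (1 + (c - 1)%:E)%E); last first.
  by rewrite -EFinD lee_fin addrC subrK.
rewrite leeD2r//.
rewrite postE//; last exact/measurable_EFinP.
under eq_integral do rewrite -EFinM /g -mulrA EFinM.
rewrite ge0_integralZl//=; first last.
- by move=> M _; rewrite lee_fin mulr_ge0 ?powR_ge0// ltW.
- by apply/measurable_EFinP; apply: measurable_funM; [exact: mE|exact: mlik].
have ev := evidence_fin_num x.
have fev0 : 0 < fine (evidence x).
  by rewrite fine_gt0// ev0 (le_lt_trans (evidence_le1 x)) ?ltry.
apply: (@le_trans _ _ ((fine (evidence x))^-1%:E *
   ((expR (- c))%:E * ((expR c)%:E * evidence x)))%E).
  by rewrite !lee_wpmul2l ?lee_fin ?expR_ge0 ?invr_ge0 ?(ltW fev0).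
rewrite -(fineK ev) -!EFinM lee_fin (mulrA (expR _)) -expRD addNr expR0 mul1r.
by rewrite mulVf// gt_eqF.
Qed.

(* Markov's inequality: the moment divided by the likelihood of [M0] to the
   power [alpha] has mean 1 over the samples drawn from [M0], because the mean of
   the likelihood ratio cancels the power of the affinity. *)
Lemma sum_large_renyi_moment T :
  \sum_(u : {ffun 'I_n -> obs d1 d2} |
      `[< ~ (\int[prior]_M ((affinity alpha Pi M M0 ^+ n)^-1 *
                             likelihood u M `^ alpha)%:E
             <= (expR T * likelihood u M0 `^ alpha)%:E)%E >])
    \prod_(s < n) PM Pi M0 (u s) <= expR (- T).
Proof.
pose W (u : {ffun 'I_n -> obs d1 d2}) := (\int[prior]_M (E M * lik u M)%:E)%E.
pose p (u : {ffun 'I_n -> obs d1 d2}) := \prod_(s < n) PM Pi M0 (u s).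
have p0 u : 0 <= p u by apply: prodr_ge0 => s _; exact: PM_ge0.
(* The Markov weight: [c u * W u] is at least 1 on every bad sample. *)
pose c (u : {ffun 'I_n -> obs d1 d2}) := expR (- T) / lik u M0.
have c0 u : 0 <= c u by rewrite divr_ge0 ?expR_ge0.
have W0 u : (0 <= W u)%E.
  by apply: integral_ge0 => M _; rewrite lee_fin mulr_ge0// ltW.
have mW u : measurable_fun setT (fun M => (E M * lik u M)%:E).
  by apply/measurable_EFinP; exact: measurable_funM.
rewrite -lee_fin -sumEFin.
apply: (@le_trans _ _ (\sum_(u : {ffun 'I_n -> obs d1 d2}) (p u * c u)%:E * W u)%E).
  rewrite big_mkcond/=; apply: lee_sum => u _.
  case: asboolP => [Wu|_]; last by rewrite mule_ge0// lee_fin mulr_ge0.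
  rewrite -/(p u) EFinM -muleA -[leLHS]mule1 lee_wpmul2l ?lee_fin//.
  have {}Wu : ((expR T * lik u M0)%:E <= W u)%E.
    by rewrite leNgt; apply/negP => /ltW /Wu.
  apply: (@le_trans _ _ ((c u)%:E * (expR T * lik u M0)%:E)%E); last first.
    by rewrite lee_wpmul2l ?lee_fin.
  rewrite -EFinM lee_fin /c mulrACA.
  rewrite -expRD addNr expR0 mul1r mulVf// gt_eqF//.
under eq_bigr => u _.
  rewrite -ge0_integralZl//=; last 2 first.
  - by move=> M _; rewrite lee_fin mulr_ge0// ltW.
  - by rewrite lee_fin mulr_ge0.
  over.
rewrite -ge0_integral_sum//=; last 2 first.
- by move=> u; apply: emeasurable_funM => //; exact: mW.
- by move=> u M _; rewrite -EFinM lee_fin; apply: mulr_ge0; apply: mulr_ge0 => //; exact: ltW.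
(* With the sum under the integral, [E M] cancels the power of the affinity for each [M], and a
   constant remains. *)
rewrite (eq_integral (cst (expR (- T))%:E)).
  by rewrite integral_cst_probability.
move=> M _; under eq_bigr do rewrite -EFinM.
rewrite sumEFin; congr EFin.
transitivity (expR (- T) * E M * \sum_(u : {ffun 'I_n -> obs d1 d2}) p u * (lik u M / lik u M0)).
  by rewrite mulr_sumr; apply: eq_bigr => u _; rewrite /c; ring.
rewrite sum_likelihood_ratio// -mulrA mulVf ?mulr1//.
by rewrite gt_eqF// exprn_gt0// affinity_gt0.
Qed.

Theorem fractional_posterior_contraction d (Omega : measurableType d)
    (P : probability Omega R) (X : 'I_n -> Omega -> obs d1 d2) T delta :
  iid_sample P X (PM Pi M0) -> 1 <= T -> n%:R * delta <= T ->
  ((expR (- T))%:E <= prior (entrywise_ball M0 delta))%E ->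
  (1 - (T^-1)%:E <=
   P [set t | \int[fractional_posterior alpha prior (fun s => X s t)]_M
                (renyi alpha (PM Pi M) (PM Pi M0))%:E
              <= (2 * (alpha + 1) / (1 - alpha) * (T / n%:R))%:E])%E.
Proof.
move=> Xiid T1 ndT priorT.
(* One half of [c] is the Markov threshold for the moment, the other half the loss in the evidence
   bound. *)
pose c := 2 * (alpha + 1) * T.
have -> : 2 * (alpha + 1) / (1 - alpha) * (T / n%:R) = c / (n%:R * (1 - alpha)).
  have ? : 1 - alpha != 0 by rewrite subr_eq0 gt_eqF.
  have ? : n%:R != 0 :> R by rewrite pnatr_eq0 -lt0n.
  by rewrite /c; field; apply/andP.
have aT0 : 0 <= alpha * T by rewrite mulr_ge0// ltW// (lt_le_trans ltr01).
apply: (iid_sample_ge (G := [set x |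
  (\int[fractional_posterior alpha prior x]_M
     (renyi alpha (PM Pi M) (PM Pi M0))%:E <= (c / (n%:R * (1 - alpha)))%:E)%E]) Xiid).
apply: (@le_trans _ _ (expR (- ((alpha + 1) * T)))); last first.
  rewrite expRN lef_pV2 ?posrE ?expR_gt0 ?(lt_le_trans ltr01)//.
  by apply: le_trans (expR_ge1Dx _); lra.
(* Every sample violating the posterior bound has a large moment, so the two sums compare
   termwise. *)
apply: le_trans (sum_large_renyi_moment ((alpha + 1) * T)).
rewrite big_mkcond [leRHS]big_mkcond/=; apply: ler_sum => x _.
case: asboolP => [bad|_]; last first.
  by case: ifP => // _; apply: prodr_ge0 => s _; exact: PM_ge0.
case: asboolP => [//|/contrapT W]; exfalso; apply: bad.
have ev := evidence_ge x ndT priorT.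
apply: posterior_renyi_le.
- by rewrite /c; lra.
- by apply: lt_le_trans ev; rewrite lte_fin mulr_gt0 ?expR_gt0.
- apply: (le_trans W).
  apply: (@le_trans _ _ ((expR c)%:E *
      (expR (- ((1 + alpha) * T)) * lik x M0)%:E)%E); last first.
    by rewrite lee_wpmul2l ?lee_fin ?expR_ge0.
  rewrite -EFinM lee_fin mulrA -expRD /lik le_eqVlt; apply/orP; left; apply/eqP.
  by rewrite /c; congr (expR _ * _); ring.
Qed.

End fractional_posterior.

(** * Mass of the hyperprior *)

Section hyperprior_mass.
Context {R : realType}.
Implicit Types a b c s u v x : R.
Local Notation mu := (@lebesgue_measure R).

(** The integrand is left as the derivative of k x^c, so that [c] = a serves below 1 and [c] = - a,
    with negative [k], above 1. *)
Lemma integral_powR (k : R) c u v : 0 < u -> u < v ->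
  (\int[mu]_(x in `[u, v]) (k * (c * x `^ (c - 1)))%:E)%E =
  (k * (v `^ c - u `^ c))%:E.
Proof.
move=> u0 uv.
have powR_derivable e x : 0 < x -> derivable (@powR R ^~ e) x 1.
  by move=> x0; apply: derivable_powR; rewrite in_itv/= x0.
have powR_cont e x : 0 < x -> {for x, continuous (@powR R ^~ e)}.
  move=> x0; apply: differentiable_continuous.
  exact/derivable1_diffP/powR_derivable.
rewrite (@continuous_FTC2 _ _ (fun x => k * x `^ c))//.
- by rewrite -EFinB mulrBr.
- apply: derivable_within_continuous => x; rewrite in_itv/= => /andP[ux _].
  apply: derivableM; first exact: derivable_cst.
  apply: derivableM; first exact: derivable_cst.
  exact/powR_derivable/(lt_le_trans u0).
- split => [x /[!in_itv]/= /andP[ux _]||].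
  + apply: derivableM; first exact: derivable_cst.
    exact/powR_derivable/(lt_trans u0).
  + apply: cvgM; first exact: cvg_cst.
    exact/cvg_at_right_filter/powR_cont.
  + apply: cvgM; first exact: cvg_cst.
    exact/cvg_at_left_filter/powR_cont/(lt_trans u0).
- move=> x /[!in_itv]/= /andP[ux _].
  have x0 : 0 < x by exact: lt_trans ux.
  rewrite derive1E deriveM; [|exact: derivable_cst|exact: powR_derivable].
  rewrite derive_cst scaler0 addr0 -derive1E.
  by rewrite powR_derive1// in_itv/= x0.
Qed.

Lemma powRD_gt0 x b c : 0 < x -> x `^ (b + c) = x `^ b * x `^ c.
Proof. by move=> x0; rewrite powRD// (gt_eqF x0) implybT. Qed.

(** Keeps a single term of the exponential series; the resulting decay absorbs powers of order 2
    a. *)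
Lemma expRN_le_fact n x : 0 < x -> expR (- x) <= n.+1`!%:R / x ^+ n.+1.
Proof.
move=> x0; have m0 : 0 < n.+1`!%:R :> R by rewrite ltr0n fact_gt0.
rewrite expRN -[leRHS]invrK lef_pV2 ?posrE ?invr_gt0 ?divr_gt0 ?exprn_gt0 ?expR_gt0//.
by rewrite invf_div; have := expR_ge1Dxn n (ltW x0); lra.
Qed.

(** * Upper bound on the normalizing constant of the hyperprior *)

Section density_bounds.
Variables (F : hyperfamily) (a b : R) (n : nat).
Hypotheses (a_gt0 : 0 < a) (b_gt0 : 0 < b) (an : a + a <= n.+1%:R :> R).

Let K : R := 1 + n.+1`!%:R / b ^+ n.+1.

Let K1 : 1 <= K.
Proof. by rewrite lerDl divr_ge0 ?exprn_ge0 ?ltW. Qed.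

Let expRN_le (y : R) : 0 < y -> expR (- y) <= 1.
Proof. by move=> y0; rewrite expR_le1 oppr_le0 ltW. Qed.

(** For the Gamma family the exponential is at most 1. For the inverse-Gamma one, exp(- b / x)
    brings x^(n + 1), which compensates the excess x^(- 2 a) because 2 a is at most n + 1. *)
Lemma hyper_density_le_powRB1 x : 0 < x -> x <= 1 ->
  hyper_density F a b x <= K * x `^ (a - 1).
Proof.
move=> x0 x1; rewrite /hyper_density x0; case: F.
  rewrite mulrC ler_wpM2r ?powR_ge0// (le_trans _ K1)// expRN_le//.
  exact: mulr_gt0.
have -> : x `^ (- a - 1) = x `^ (- a - a) * x `^ (a - 1).
  by rewrite -powRD_gt0//; congr powR; ring.
rewrite mulrAC ler_wpM2r ?powR_ge0//.
have := expRN_le_fact n (divr_gt0 b_gt0 x0) => /(ler_wpM2l (powR_ge0 x (- a - a))).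
move=> /le_trans; apply.
have -> : n.+1`!%:R / (b / x) ^+ n.+1 = n.+1`!%:R / b ^+ n.+1 * x `^ n.+1%:R.
  by rewrite powR_mulrn ?ltW// expr_div_n invf_div mulrA mulrAC.
rewrite mulrCA -powRD_gt0//.
apply: (@le_trans _ _ (n.+1`!%:R / b ^+ n.+1)); last by rewrite /K lerDr.
rewrite ler_piMr ?divr_ge0 ?exprn_ge0 ?(ltW b_gt0)//.
by rewrite -[leRHS](powRr0 x); apply: ger_powR; [rewrite x0 x1|rewrite -opprD addrC subr_ge0].
Qed.

(** Mirror image of the bound on ]0, 1]: the two families exchange roles. *)
Lemma hyper_density_le_powRNB1 x : 1 <= x ->
  hyper_density F a b x <= K * x `^ (- a - 1).
Proof.
move=> x1; have x0 : 0 < x by exact: lt_le_trans x1.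
rewrite /hyper_density x0; case: F; last first.
  rewrite mulrC ler_wpM2r ?powR_ge0// (le_trans _ K1)// expRN_le//.
  exact: divr_gt0.
have -> : x `^ (a - 1) = x `^ (a + a) * x `^ (- a - 1).
  by rewrite -powRD_gt0//; congr powR; ring.
rewrite mulrAC ler_wpM2r ?powR_ge0//.
have := expRN_le_fact n (mulr_gt0 b_gt0 x0) => /(ler_wpM2l (powR_ge0 x (a + a))).
move=> /le_trans; apply.
have -> : n.+1`!%:R / (b * x) ^+ n.+1 = n.+1`!%:R / b ^+ n.+1 * x `^ (- n.+1%:R).
  by rewrite powR_invn ?ltW// exprMn invfM mulrA.
rewrite mulrCA -powRD_gt0//.
apply: (@le_trans _ _ (n.+1`!%:R / b ^+ n.+1)); last by rewrite /K lerDr.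
rewrite ler_piMr ?divr_ge0 ?exprn_ge0 ?(ltW b_gt0)//.
by rewrite -[leRHS](powRr0 x); apply: ler_powR; rewrite ?subr_le0.
Qed.

Let mdens D : measurable_fun D (fun x => (hyper_density F a b x)%:E).
Proof. by apply/measurable_EFinP/measurable_funTS; exact: measurable_hyper_density. Qed.

Let dens0 x : (0 <= (hyper_density F a b x)%:E)%E.
Proof. by rewrite lee_fin hyper_density_ge0. Qed.

Let mpow c D : measurable_fun D (fun x : R => (K / a * (a * x `^ c))%:E).
Proof.
apply/measurable_EFinP/measurable_funTS; by do 2 apply: measurable_funM => //.
Qed.

(** The comparison powers integrate to at most 1 / a on each side of 1. *)
Lemma integral_hyper_density_itv_le u v : 0 < u -> u < 1 -> 1 < v ->
  (\int[mu]_(x in `[u, v]) (hyper_density F a b x)%:E <= (K * (2 / a))%:E)%E.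
Proof.
move=> u0 u1 v1; have aK0 : 0 <= K / a by rewrite divr_ge0 ?(ltW a_gt0)// (le_trans ler01).
have aKa y : K * y = K / a * (a * y) by rewrite mulrA divfK// gt_eqF.
have -> : `[u, v]%classic = `[u, 1]%classic `|` `]1, v]%classic.
  by rewrite -itv_bndbnd_setU// bnd_simp ltW.
rewrite ge0_integral_setU//=; last first.
  by apply/disj_setPS => x /= [] /[!in_itv]/=; lra.
  exact: mdens.
have -> : K * (2 / a) = K / a + K / a by ring.
rewrite EFinD leeD//.
  apply: (@le_trans _ _ (\int[mu]_(x in `[u, 1%R]) (K / a * (a * x `^ (a - 1)))%:E)%E).
    apply: ge0_le_integral; [by []|by move=> *; exact: dens0|exact: mdens|exact: mpow|].
    move=> x /=; rewrite in_itv/= => /andP[ux x1].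
    by rewrite lee_fin -aKa hyper_density_le_powRB1// (lt_le_trans u0).
  by rewrite integral_powR// lee_fin powR1 ler_piMr// lerBlDr lerDl powR_ge0.
apply: (@le_trans _ _ (\int[mu]_(x in `[1%R, v]) (hyper_density F a b x)%:E)%E).
  apply: ge0_subset_integral; [by []|by []|exact: mdens|by move=> *; exact: dens0|].
  by apply: subset_itv; rewrite bnd_simp.
apply: (@le_trans _ _ (\int[mu]_(x in `[1%R, v]) (- (K / a) * (- a * x `^ (- a - 1)))%:E)%E).
  apply: ge0_le_integral; [by []|by move=> *; exact: dens0|exact: mdens| |].
  - apply/measurable_EFinP/measurable_funTS.
    by apply: measurable_funM => //; apply: measurable_funM => //; exact: measurable_powR.
  - move=> x /=; rewrite in_itv/= => /andP[x1 _].
    by rewrite lee_fin mulNr mulNr mulrN opprK -aKa hyper_density_le_powRNB1.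
rewrite integral_powR// lee_fin powR1 mulNr -mulrN opprB ler_piMr//.
by rewrite lerBlDr lerDl powR_ge0.
Qed.

Lemma integral_hyper_density_le :
  (\int[mu]_x (hyper_density F a b x)%:E <= (K * (2 / a))%:E)%E.
Proof.
(* Compact intervals exhausting the positive half-line; starting at 2 puts 1 strictly inside each of
   them. *)
pose I (k : nat) : set (measurableTypeR R) := `[k.+2%:R^-1 : R, k.+2%:R]%classic.
have UI : \bigcup_k I k = `]0, +oo[%classic.
  apply/seteqP; split => x /=; rewrite /I.
    move=> [k _] /=; rewrite !in_itv/= andbT => /andP[+ _].
    by apply: lt_le_trans; rewrite invr_gt0.
  rewrite in_itv/= andbT => x0.
  pose k := Num.truncn (Num.max x x^-1).
  exists k => //=; rewrite in_itv/=.
  have kx : Num.max x x^-1 < k.+1%:R by exact: truncnS_gt.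
  have {}kx : Num.max x x^-1 <= k.+2%:R by rewrite ltW// (lt_trans kx)// ltr_nat.
  move: kx; rewrite ge_max => /andP[-> kx]; rewrite andbT.
  by rewrite -[leRHS]invrK lef_pV2 ?posrE ?invr_gt0.
have -> : (\int[mu]_x (hyper_density F a b x)%:E =
    \int[mu]_(x in \bigcup_k I k) (hyper_density F a b x)%:E)%E.
  rewrite [RHS]integral_mkcond; apply: eq_integral => x _.
  rewrite patchE UI; case: ifPn => //; rewrite notin_setE/= in_itv/= andbT.
  by move=> /negP x0; rewrite /hyper_density (negbTE x0).
have ndI : nondecreasing_seq I.
  apply/nondecreasing_seqP => k; apply/subsetPset.
  apply: subset_itv; rewrite bnd_simp ?ler_nat//.
  by rewrite lef_pV2 ?posrE// ler_nat.
have mI (k : nat) : measurable (I k) by exact: measurable_itv.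
have cvgI := @ge0_nondecreasing_set_cvg_integral _ _ _ I
  (fun x => (hyper_density F a b x)%:E) mu ndI mI (fun k => @mdens _)
  (fun _ x _ => dens0 x).
apply: (cvge_le _ cvgI).
apply: nearW => k; apply: integral_hyper_density_itv_le.
- by rewrite invr_gt0.
- by rewrite invf_lt1// ltr1n.
- by rewrite ltr1n.
Qed.

End density_bounds.

(** On a dyadic interval the factor 1 / x is at least 1 / (2 s), which against the length s leaves 1
    / 2. The exponent is at most [q] for Gamma, and at most 1 for inverse-Gamma because [b] is at
    most [s]. *)
Lemma integral_hyper_density_ge (F : hyperfamily) a b s (kappa q : R) :
  0 < a -> 0 < b -> b <= s -> 0 < kappa -> 0 <= q ->
  kappa <= s `^ a -> kappa <= (s + s) `^ (- a) -> b * (s + s) <= q ->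
  ((kappa / 2 * expR (- (1 + q)))%:E <=
    \int[mu]_(x in `[s, (s + s)%R]) (hyper_density F a b x)%:E)%E.
Proof.
move=> a0 b0 bs k0 q0 ks kss bq; have s0 : 0 < s by exact: lt_le_trans bs.
apply: (@le_trans _ _ (\int[mu]_(x in `[s, (s + s)%R])
    (kappa / (s + s) * expR (- (1 + q)))%:E)%E).
  rewrite integral_cst//= lebesgue_measure_itv/= lte_fin ltrDl s0.
  rewrite -EFinB -EFinM lee_fin le_eqVlt; apply/orP; left; apply/eqP.
  have ? : s != 0 by rewrite gt_eqF.
  have ? : s + s != 0 by rewrite gt_eqF// addr_gt0.
  by field.
apply: ge0_le_integral; [by []| |by []| |].
- by move=> x _; rewrite lee_fin mulr_ge0 ?expR_ge0// divr_ge0 ?addr_ge0 ?ltW.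
- by apply/measurable_EFinP/measurable_funTS; exact: measurable_hyper_density.
move=> x /=; rewrite in_itv/= => /andP[sx xs].
have x0 : 0 < x by exact: lt_le_trans sx.
rewrite lee_fin /hyper_density x0.
have xV : (s + s)^-1 <= x^-1 by rewrite lef_pV2// posrE addr_gt0.
have xV0 : 0 <= (s + s)^-1 by rewrite invr_ge0 addr_ge0// ltW.
case: F.
- apply: ler_pM; rewrite ?expR_ge0 ?mulr_ge0 ?(ltW k0)//.
    rewrite powRD_gt0// powR_inv1 ?(ltW x0)//; apply: ler_pM => //; first exact: ltW.
    by rewrite (le_trans ks)// ge0_ler_powR ?nnegrE ?(ltW a0) ?(ltW s0) ?(ltW x0).
  rewrite ler_expR lerN2; have : b * x <= b * (s + s) by rewrite ler_pM2l.
  by move: bq; lra.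
- apply: ler_pM; rewrite ?expR_ge0 ?mulr_ge0 ?(ltW k0)//.
    rewrite powRD_gt0// powR_inv1 ?(ltW x0)//; apply: ler_pM => //; first exact: ltW.
    rewrite (le_trans kss)// !powRN lef_pV2 ?posrE ?powR_gt0 ?addr_gt0//.
    by rewrite ge0_ler_powR ?nnegrE ?(ltW a0) ?addr_ge0 ?(ltW s0) ?(ltW x0).
  rewrite ler_expR lerN2; have : b / x <= 1.
    by rewrite ler_pdivrMr// mul1r (le_trans bs).
  by move: q0; lra.
Qed.

Lemma hyperprior_ge (F : hyperfamily) a b s (kappa q : R) n :
  0 < a -> 0 < b -> a + a <= n.+1%:R :> R ->
  b <= s -> 0 < kappa -> 0 <= q ->
  kappa <= s `^ a -> kappa <= (s + s) `^ (- a) -> b * (s + s) <= q ->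
  ((kappa / 2 * expR (- (1 + q)) /
      ((1 + n.+1`!%:R / b ^+ n.+1) * (2 / a)))%:E <=
    hyperprior F a b `[s, (s + s)%R]%classic)%E.
Proof.
move=> a0 b0 an bs k0 q0 ks kss bq.
have lo := integral_hyper_density_ge F a0 b0 bs k0 q0 ks kss bq.
have up := integral_hyper_density_le F a0 b0 an.
set lo_ := (_ * expR _) in lo *; set up_ := ((1 + _) * _) in up *.
have lo0 : 0 < lo_ by rewrite mulr_gt0 ?expR_gt0// divr_gt0.
rewrite /hyperprior/= /mnormalize/= /density_measure/=.
set Z := (\int[mu]_x _)%E in up *.
have ZA : (\int[mu]_(x in `[s, (s + s)%R]) (hyper_density F a b x)%:E <= Z)%E.
  apply: ge0_subset_integral => //.
  - by apply/measurable_EFinP; exact: measurable_hyper_density.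
  - by move=> x _; rewrite lee_fin hyper_density_ge0.
(* With both bounds [Z] is positive and finite, so the default of [mnormalize] is excluded. *)
have Z0 : (0 < Z)%E by rewrite (lt_le_trans _ ZA)// (lt_le_trans _ lo)// lte_fin.
have Zy : (Z < +oo)%E by rewrite (le_lt_trans up)// ltry.
rewrite (gt_eqF Z0) (lt_eqF Zy)/= EFinM.
have Zf : Z \is a fin_num by rewrite ge0_fin_numE// ltW.
have fZ0 : 0 < fine Z by rewrite fine_gt0// Z0.
apply: lee_pmul => //; first by rewrite lee_fin ltW.
- by rewrite lee_fin invr_ge0 -lee_fin (le_trans (ltW Z0)).
- rewrite lee_fin lef_pV2 ?posrE -?lee_fin ?fineK//.
  by rewrite -lte_fin (lt_le_trans Z0).
Qed.

(** Turns constants into powers of 1 / N, uniformly in N, since 2^m exceeds m. *)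
Lemma exists_exprV_le (k : R) : 0 < k ->
  exists q : nat, forall N : R, 2 <= N -> N^-1 ^+ q <= k.
Proof.
move=> k0; exists (Num.bound k^-1) => N N2.
have N0 : 0 < N by apply: lt_le_trans N2.
rewrite -[leRHS]invrK exprVn lef_pV2 ?posrE ?invr_gt0 ?exprn_gt0//.
apply: (@le_trans _ _ ((Num.bound k^-1)%:R : R)).
  by rewrite ltW// archi_boundP// invr_ge0 ltW.
apply: (@le_trans _ _ (2 ^+ Num.bound k^-1)).
  by rewrite -natrX ler_nat ltnW// ltn_expl.
by rewrite lerXn2r// nnegrE// ltW.
Qed.

(** The point is uniformity: [q] is chosen before [N], [b] and [s]. The rates N^8 and N^3 are those
    supplied by [hyperparameter_scales]. *)
Lemma hyperprior_ge_exprV (a beta sigma S : R) :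
  0 < a -> 0 < beta -> 0 < sigma -> 0 < S ->
  exists q : nat, forall (F : hyperfamily) (N b s : R), 2 <= N ->
    beta / N ^+ 8 <= b -> b <= s -> sigma / N ^+ 3 <= s -> s <= S ->
    ((N^-1 ^+ q)%:E <= hyperprior F a b `[s, (s + s)%R]%classic)%E.
Proof.
move=> a0 be0 sg0 S0.
pose n := Num.bound (a + a).
have an : a + a <= n.+1%:R :> R.
  apply: ltW; apply: (@lt_trans _ _ (n%:R : R)); last by rewrite ltr_nat.
  by rewrite archi_boundP// addr_ge0// ltW.
have an1 : a <= n.+1%:R :> R by apply: le_trans an; rewrite lerDl ltW.
pose k1 : R := Num.min (sigma `^ a) ((S + S) `^ (- a)).
have k10 : 0 < k1 by rewrite lt_min !powR_gt0// addr_gt0.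
pose e : R := expR (- (1 + S * (S + S))).
have e0 : 0 < e by exact: expR_gt0.
pose f : R := n.+1`!%:R.
have f0 : 0 <= f by exact: ler0n.
pose c : R := k1 / 2 * e / ((1 + f / beta ^+ n.+1) * (2 / a)).
have den0 : 0 < 1 + f / beta ^+ n.+1.
  by rewrite ltr_pwDl// divr_ge0// exprn_ge0// ltW.
have c0 : 0 < c by rewrite /c divr_gt0 ?mulr_gt0 ?invr_gt0.
have [q qc] := exists_exprV_le c0.
(* [q] absorbs the constant [c]; 3 (n + 1) pays for s^a with s of order at least N^(- 3); 8 (n + 1)
   pays for b^(- n - 1) in the normalizing constant. *)
exists (q + (3 * n.+1 + 8 * n.+1))%N => F N b s N2 beb bs sgs sS.
have N0 : 0 < N by apply: lt_le_trans N2.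
have N1 : 1 <= N by apply: le_trans N2; rewrite ler1n.
have NX0 k : 0 < N ^+ k by rewrite exprn_gt0.
have NX1 k : 1 <= N ^+ k by rewrite exprn_ege1.
have b0 : 0 < b by apply: lt_le_trans beb; rewrite divr_gt0.
have s0 : 0 < s by exact: lt_le_trans bs.
pose k : R := k1 * N^-1 ^+ (3 * n.+1).
have k0 : 0 < k by rewrite mulr_gt0// exprn_gt0// invr_gt0.
have NV1 j : N ^- j <= 1 by rewrite invf_le1.
have ka : k <= s `^ a.
  apply: (@le_trans _ _ ((sigma / N ^+ 3) `^ a)); last first.
    by apply: ge0_ler_powR; rewrite ?nnegrE ?(ltW a0) ?(ltW s0) ?divr_ge0 ?(ltW sg0) ?(ltW (NX0 _)).
  rewrite powRM ?invr_ge0 ?(ltW sg0) ?(ltW (NX0 _))//.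
  rewrite /k; apply: ler_pM; rewrite ?exprn_ge0 ?invr_ge0 ?(ltW k10) ?(ltW N0)//.
    by rewrite ge_min lexx.
  rewrite exprM exprVn -[leLHS]powR_mulrn ?invr_ge0 ?(ltW (NX0 _))//.
  by apply: ger_powR; rewrite ?invr_gt0 ?NX0 ?NV1.
have kaN : k <= (s + s) `^ (- a).
  apply: (@le_trans _ _ k1).
    by rewrite /k ler_piMr ?(ltW k10)// exprVn.
  apply: (@le_trans _ _ ((S + S) `^ (- a))); first by rewrite ge_min lexx orbT.
  rewrite !powRN lef_pV2 ?posrE ?powR_gt0 ?addr_gt0//.
  by apply: ge0_ler_powR; rewrite ?nnegrE ?addr_ge0 ?lerD ?(ltW a0) ?(ltW s0) ?(ltW S0).
have bq : b * (s + s) <= S * (S + S).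
  by rewrite ler_pM ?lerD ?addr_ge0 ?(ltW s0) ?(ltW b0)// (le_trans bs).
have q0 : 0 <= S * (S + S) by rewrite mulr_ge0 ?addr_ge0// ltW.
apply: le_trans (hyperprior_ge F a0 b0 an bs k0 q0 ka kaN bq).
rewrite lee_fin exprD; apply: (@le_trans _ _ (c * N^-1 ^+ (3 * n.+1 + 8 * n.+1))).
  by rewrite ler_wpM2r ?qc// exprn_ge0// invr_ge0 ltW.
rewrite -/e -/f.
have denb0 : 0 < 1 + f / b ^+ n.+1.
  by rewrite ltr_pwDl// divr_ge0// exprn_ge0// ltW.
have -> : k / 2 * e / ((1 + f / b ^+ n.+1) * (2 / a)) =
   (k1 / 2 * e / (2 / a) * N^-1 ^+ (3 * n.+1)) * (1 + f / b ^+ n.+1)^-1.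
  by rewrite /k !invfM; ring.
have -> : c * N^-1 ^+ (3 * n.+1 + 8 * n.+1) =
   (k1 / 2 * e / (2 / a) * N^-1 ^+ (3 * n.+1)) *
     ((1 + f / beta ^+ n.+1) * N ^+ (8 * n.+1))^-1.
  by rewrite /c exprD [N^-1 ^+ (8 * _)]exprVn !invfM; ring.
rewrite ler_wpM2l//.
  apply: mulr_ge0; last by rewrite exprn_ge0// invr_ge0 ltW.
  by apply: divr_ge0; [rewrite !mulr_ge0 ?invr_ge0 ?(ltW k10) ?(ltW e0)|
    rewrite divr_ge0 ?(ltW a0)].
rewrite lef_pV2 ?posrE//; last exact: mulr_gt0.
rewrite mulrDl mul1r lerD//.
rewrite -mulrA ler_wpM2l// exprM -!exprVn -exprMn.
rewrite lerXn2r// ?nnegrE ?mulr_ge0 ?invr_ge0 ?exprn_ge0 ?(ltW b0) ?(ltW be0) ?(ltW N0)//.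
by rewrite mulrC -invf_div lef_pV2 ?posrE ?divr_gt0.
Qed.

End hyperprior_mass.

(** * Mass of the prior near a low-rank matrix *)

Section normal_itv.
Context {R : realType}.
Implicit Types B sigma tau u x : R.
Local Notation mu := (@lebesgue_measure R).

(** On the interval |x| is at most 2 B, so the exponent is at most 2; the peak is at least 1 / (4
    B), because pi is at most 4. The length is 2 tau. *)
Lemma normal_prob_itv_ge B sigma tau u : 0 < B -> 0 < sigma ->
  B ^+ 2 <= sigma ^+ 2 -> sigma ^+ 2 <= 2 * B ^+ 2 ->
  `|u| <= B -> 0 < tau -> tau <= B ->
  ((tau / B * (expR (- 2) / 2))%:E <=
    normal_prob 0 sigma `[(u - tau)%R, (u + tau)%R]%classic)%E.
Proof.
move=> B0 s0 Bs sB uB t0 tB.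
have B20 : 0 < B ^+ 2 by rewrite exprn_gt0.
have s20 : 0 < sigma ^+ 2 by rewrite exprn_gt0.
apply: (@le_trans _ _ (\int[mu]_(x in `[(u - tau)%R, (u + tau)%R])
    ((4 * B)^-1 * expR (- 2))%:E)%E).
  rewrite integral_cst//= lebesgue_measure_itv/= lte_fin.
  rewrite ifT; last by move: t0; lra.
  rewrite -EFinB -EFinM lee_fin le_eqVlt; apply/orP; left; apply/eqP.
  by field; rewrite gt_eqF.
apply: ge0_le_integral; [by []| |by []| |].
- by move=> x _; rewrite lee_fin mulr_ge0 ?expR_ge0// invr_ge0 mulr_ge0// ltW.
- by apply/measurable_EFinP/measurable_funTS; exact: measurable_normal_pdf.
move=> x /=; rewrite in_itv/= => /andP[ux xu].
rewrite lee_fin normal_pdfE ?gt_eqF//; apply: ler_pM.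
- by rewrite invr_ge0 mulr_ge0// ltW.
- exact: expR_ge0.
- rewrite /normal_peak lef_pV2 ?posrE ?mulr_gt0//; last first.
    by rewrite sqrtr_gt0 pmulrn_lgt0// mulr_gt0// pi_gt0.
  have -> : 4 * B = Num.sqrt ((4 * B) ^+ 2) by rewrite sqrtr_sqr ger0_norm// mulr_ge0// ltW.
  rewrite ler_wsqrtr// -mulr_natr exprMn.
  have pi4 : (pi : R) <= 4 by have := pihalf_lt2 R; lra.
  have : sigma ^+ 2 * pi <= 2 * B ^+ 2 * 4 by rewrite ler_pM// ?(ltW s20)// pi_ge0.
  lra.
- rewrite ler_expR subr0 mulNr lerN2 ler_pdivrMr; last by rewrite pmulrn_lgt0.
  have xB : `|x| <= 2 * B.
    move: uB; rewrite !ler_norml => /andP[uB1 uB2]; apply/andP; split; lra.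
  have : x ^+ 2 <= (2 * B) ^+ 2.
    by rewrite -(ger0_norm (sqr_ge0 x)) normrX lerXn2r ?nnegrE// mulr_ge0// ltW.
  rewrite exprMn -mulr_natr; lra.
Qed.

(* The comparison density has total mass 1, so no tail integral is computed. *)
Lemma normal_pdf_tail_le sigma tau x : 0 < sigma -> 0 < tau -> tau <= `|x| ->
  normal_pdf 0 sigma x <=
  8 * (sigma ^+ 2 / tau ^+ 2) * normal_pdf 0 (2 * sigma) x.
Proof.
move=> s0 t0 tx.
have s20 : 0 < sigma ^+ 2 by rewrite exprn_gt0.
have t20 : 0 < tau ^+ 2 by rewrite exprn_gt0.
rewrite !normal_pdfE ?gt_eqF ?mulr_gt0//.
have -> : normal_peak sigma = 2 * normal_peak (2 * sigma).
  rewrite /normal_peak.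
  have -> : (2 * sigma) ^+ 2 * pi *+ 2 = 2 ^+ 2 * (sigma ^+ 2 * pi *+ 2).
    by rewrite exprMn -mulrA mulrnAr.
  by rewrite sqrtrM ?sqr_ge0// sqrtr_sqr ger0_norm// invfM mulrA mulfV// mul1r.
(* The gap 1/2 - 1/8 between the two Gaussian exponents; exp(- y) is then bounded by 1 / y. *)
pose y := 3 * x ^+ 2 / (8 * sigma ^+ 2).
have -> : normal_fun 0 sigma x = expR (- y) * normal_fun 0 (2 * sigma) x.
  rewrite /normal_fun -expRD; congr expR; rewrite subr0 /y.
  have -> : sigma ^+ 2 *+ 2 = 2 * sigma ^+ 2 by ring.
  have -> : (2 * sigma) ^+ 2 *+ 2 = 8 * sigma ^+ 2 by ring.
  by field; rewrite gt_eqF.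
have x20 : tau ^+ 2 <= x ^+ 2.
  by rewrite -(ger0_norm (sqr_ge0 x)) normrX lerXn2r ?nnegrE// ltW.
have x2 : 0 < x ^+ 2 by exact: lt_le_trans x20.
have y0 : 0 < y by apply: divr_gt0; apply: mulr_gt0.
have yV : expR (- y) <= y^-1.
  by rewrite expRN lef_pV2 ?posrE ?expR_gt0//; have := expR_ge1Dx y; lra.
have -> : 2 * normal_peak (2 * sigma) * (expR (- y) * normal_fun 0 (2 * sigma) x) =
    2 * expR (- y) * (normal_peak (2 * sigma) * normal_fun 0 (2 * sigma) x) by ring.
rewrite ler_wpM2r ?mulr_ge0 ?normal_fun_ge0 ?normal_peak_ge0//.
apply: (@le_trans _ _ (2 * y^-1)); first by rewrite ler_pM2l.
have -> : 2 * y^-1 = 16 / 3 * (sigma ^+ 2 / x ^+ 2).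
  have xn0 : x != 0 by rewrite -sqrf_eq0 gt_eqF.
  by rewrite /y; field; rewrite xn0 gt_eqF.
have : sigma ^+ 2 / x ^+ 2 <= sigma ^+ 2 / tau ^+ 2 by rewrite ler_pM2l// lef_pV2.
have : 0 <= sigma ^+ 2 / tau ^+ 2 by rewrite divr_ge0// ltW.
lra.
Qed.

(** A Chebyshev-type bound, from the tail comparison integrated over the complement. *)
Lemma normal_prob_itvNxx_ge sigma tau : 0 < sigma -> 0 < tau ->
  ((1 - 8 * (sigma ^+ 2 / tau ^+ 2))%:E <=
    normal_prob 0 sigma `[(- tau)%R, tau]%classic)%E.
Proof.
move=> s0 t0; set A := `[_, _]%classic; set c := 8 * _.
have mA : measurable A by exact: measurable_itv.
have c0 : 0 <= c by rewrite mulr_ge0// divr_ge0// sqr_ge0.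
have tail : (normal_prob 0 sigma (~` A) <= c%:E)%E.
  apply: (@le_trans _ _ (\int[mu]_(x in ~` A) (c * normal_pdf 0 (2 * sigma) x)%:E)%E).
    apply: ge0_le_integral; [exact: measurableC| | | |].
    - by move=> x _; rewrite lee_fin normal_pdf_ge0.
    - by apply/measurable_EFinP/measurable_funTS; exact: measurable_normal_pdf.
    - apply/measurable_EFinP/measurable_funTS; apply: measurable_funM => //.
      exact: measurable_normal_pdf.
    - move=> x /= /negP; rewrite in_itv/= -ler_norml -ltNge => /ltW tx.
      by rewrite lee_fin normal_pdf_tail_le.
  under eq_integral do rewrite EFinM.
  rewrite ge0_integralZl//=; last 3 first.
  - exact: measurableC.
  - by apply/measurable_EFinP/measurable_funTS; exact: measurable_normal_pdf.
  - by move=> x _; rewrite lee_fin normal_pdf_ge0.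
  rewrite -[leRHS]mule1 lee_wpmul2l// -(integral_normal_pdf 0 (2 * sigma)).
  apply: ge0_subset_integral => //.
  - exact: measurableC.
  - by apply/measurable_EFinP; exact: measurable_normal_pdf.
  - by move=> x _; rewrite lee_fin normal_pdf_ge0.
have -> : normal_prob 0 sigma A = (1 - normal_prob 0 sigma (~` A))%E.
  have := probability_setC (normal_prob 0 sigma) (measurableC mA).
  by rewrite setCK.
by rewrite EFinB leeB.
Qed.

End normal_itv.

Section integral_lower_bound.
Import HBNNSimple.

(* [f] need not be measurable: the integral of a nonnegative function is the
   supremum over the simple functions below it. *)
Lemma ge0_integral_ge_cst d (T : measurableType d) (R : realType)
    (mu : {measure set T -> \bar R}) (D : set T) (f : T -> \bar R) (c : R) :
  measurable D -> 0 <= c -> (forall x, D x -> c%:E <= f x)%E ->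
  (c%:E * mu D <= \int[mu]_(x in D) f x)%E.
Proof.
move=> mD c0 cf.
rewrite ge0_integralE; last by move=> x /cf; apply: le_trans; rewrite lee_fin.
pose h := scale_nnsfun (indic_nnsfun R mD) c0.
have hE x : h x = c * \1_D x by [].
have -> : (c%:E * mu D = sintegral mu h)%E.
  rewrite -integralT_nnsfun.
  under eq_integral do rewrite hE EFinM.
  rewrite ge0_integralZl//=.
  - by rewrite integral_indic// setIT.
  - by apply/measurable_EFinP; exact: measurable_indic.
apply: ereal_sup_ubound; exists h => // x; rewrite hE patchE indicE.
by case: ifPn => [/[!inE] Dx|_]; rewrite ?mulr1 ?mulr0//; exact: cf.
Qed.

End integral_lower_bound.

Lemma lee_prodEFin (R : realType) (I : Type) (s : seq I) (P : pred I)
    (g : I -> R) (f : I -> \bar R) :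
  (forall i, P i -> 0 <= g i) -> (forall i, P i -> (g i)%:E <= f i)%E ->
  ((\prod_(i <- s | P i) g i)%:E <= \prod_(i <- s | P i) f i)%E.
Proof.
move=> g0 gf; suff [] : 0 <= \prod_(i <- s | P i) g i /\
  ((\prod_(i <- s | P i) g i)%:E <= \prod_(i <- s | P i) f i)%E by [].
elim/big_rec2 : _ => [//|i y x Pi [x0 xy]]; split; first by rewrite mulr_ge0 ?g0.
by rewrite EFinM lee_pmul ?lee_fin ?g0 ?gf.
Qed.

(** * Boxes of the hierarchy and perturbation of the product of the factors *)

Section factorization_prior.
Context {R : realType}.

Lemma normal_diag_ge K (gamma : 'I_K -> R) (S : 'I_K -> set R) (g : 'I_K -> R) :
  (forall k, 0 <= g k) ->
  (forall k, (g k)%:E <= normal_prob 0 (Num.sqrt (gamma k)) (S k))%E ->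
  ((\prod_(k < K) g k)%:E <= normal_diag gamma S)%E.
Proof. by move=> g0 gS; apply: lee_prodEFin. Qed.

(** The bounds [g] hold throughout the box [A] of hyperparameters, so the conditional probability is
    at least a constant there. Each of the d1 + d2 rows contributes one product of the [g k]. *)
Lemma factor_hierarchy_ge d (Omega : measurableType d) (Q : probability Omega R)
    d1 d2 K (pigamma : probability (measurableTypeR R) R)
    (gamma : 'I_K -> {RV Q >-> R})
    (L : {RV Q >-> 'M[R]_(d1, K)}) (Rm : {RV Q >-> 'M[R]_(d2, K)})
    (A : 'I_K -> set R) (SL : 'I_d1 -> 'I_K -> set R)
    (SR : 'I_d2 -> 'I_K -> set R) (g : 'I_K -> R) (p : R) :
  factor_hierarchy pigamma gamma L Rm ->
  (forall k, measurable (A k)) ->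
  (forall i k, measurable (SL i k)) -> (forall j k, measurable (SR j k)) ->
  0 <= p -> (forall k, 0 <= g k) -> (forall k, p%:E <= pigamma (A k))%E ->
  (forall i k x, A k x -> (g k)%:E <= normal_prob 0 (Num.sqrt x) (SL i k))%E ->
  (forall j k x, A k x -> (g k)%:E <= normal_prob 0 (Num.sqrt x) (SR j k))%E ->
  (((\prod_(k < K) g k) ^+ (d1 + d2) * p ^+ K)%:E <=
   Q [set t | [/\ forall k, A k (gamma k t),
                  forall i k, SL i k (L t i k)
                & forall j k, SR j k (Rm t j k)]])%E.
Proof.
move=> [hgamma hLR] mA mSL mSR p0 g0 pA gL gR.
rewrite hLR//; set E := [set t | _].
have mE : measurable E.
  rewrite (_ : E = \bigcap_(k in [set: 'I_K]) (gamma k @^-1` A k)).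
    apply: fin_bigcap_measurable => // k _.
    by rewrite -[X in measurable X]setTI; exact: measurable_funPT.
  by apply/seteqP; split => t Et k => [_|]; exact: Et.
have c0 : 0 <= \prod_(k < K) g k by apply: prodr_ge0 => k _.
apply: (@le_trans _ _ (((\prod_(k < K) g k) ^+ (d1 + d2))%:E * Q E)%E).
  rewrite EFinM lee_wpmul2l ?lee_fin ?exprn_ge0// hgamma//.
  rewrite -[X in p ^+ X]card_ord -prodr_const.
  by apply: lee_prodEFin => k _.
apply: ge0_integral_ge_cst => //; first by rewrite exprn_ge0.
move=> t Et; rewrite exprD EFinM.
have cE (c : R) m : c ^+ m = \prod_(i < m) c by rewrite prodr_const card_ord.
rewrite (cE _ d1) (cE _ d2); apply: lee_pmul; rewrite ?lee_fin ?prodr_ge0//.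
- by apply: lee_prodEFin => // i _; apply: normal_diag_ge => // k; exact: gL.
- by apply: lee_prodEFin => // j _; apply: normal_diag_ge => // k; exact: gR.
Qed.

(** Bernoulli's inequality. *)
Lemma onem_exprn_ge (x : R) n : 0 <= x -> x <= 1 -> 1 - n%:R * x <= (1 - x) ^+ n.
Proof.
move=> x0 x1; elim: n => [|n ih]; first by rewrite mul0r subr0 expr0.
rewrite exprSr; apply: (@le_trans _ _ ((1 - n%:R * x) * (1 - x))).
  have : 0 <= (n%:R : R) * x * x by rewrite !mulr_ge0.
  by rewrite -natr1; lra.
by rewrite ler_wpM2r// subr_ge0.
Qed.

(** Each column contributes one quadratic and two linear error terms, all at most [B * tau] because
    [tau] is at most [B]. *)
Lemma mulmxt_close d1 d2 K (U L : 'M[R]_(d1, K)) (V Q : 'M[R]_(d2, K)) (B tau : R) :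
  tau <= B ->
  (forall i k, `|U i k| <= B) -> (forall j k, `|V j k| <= B) ->
  (forall i k, `|L i k - U i k| <= tau) -> (forall j k, `|Q j k - V j k| <= tau) ->
  forall i j, `|(L *m Q^T) i j - (U *m V^T) i j| <= K%:R * (3 * B * tau).
Proof.
move=> tB UB VB LU QV i j; rewrite !mxE -sumrB.
apply: (le_trans (ler_norm_sum _ _ _)).
rewrite -[X in X%:R * _]card_ord mulr_natl -sumr_const; apply: ler_sum => k _.
rewrite !mxE.
have -> : L i k * Q j k - U i k * V j k =
  (L i k - U i k) * (Q j k - V j k) + U i k * (Q j k - V j k) +
  (L i k - U i k) * V j k by ring.
have t0 : 0 <= tau by exact: le_trans (LU i k).
have n1 : `|(L i k - U i k) * (Q j k - V j k)| <= B * tau.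
  by rewrite normrM ler_pM ?normr_ge0// (le_trans (LU i k)).
have n2 : `|U i k * (Q j k - V j k)| <= B * tau.
  by rewrite normrM ler_pM ?normr_ge0.
have n3 : `|(L i k - U i k) * V j k| <= B * tau.
  by rewrite normrM mulrC ler_pM ?normr_ge0.
have := ler_normD ((L i k - U i k) * (Q j k - V j k) + U i k * (Q j k - V j k)) ((L i k - U i k) * V j k).
have := ler_normD ((L i k - U i k) * (Q j k - V j k)) (U i k * (Q j k - V j k)).
lra.
Qed.

End factorization_prior.

(** * Prior mass of the ball around a low-rank matrix *)

Section prior_mass.
Context {R : realType}.

Let prod_ltn K r (c : R) : (r <= K)%N ->
  \prod_(k < K) (if (k < r)%N then c else 1) = c ^+ r.
Proof.
move=> rK; rewrite -big_mkcond/= -(big_ord_widen _ (fun=> c) rK).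
by rewrite prodr_const card_ord.
Qed.

(* [sm] is the scale of the hyperparameters of the columns of index >= r; it is
   small enough to keep these columns below [tau] and large enough compared
   with [b] for the inverse-Gamma hyperprior. *)
Let hyperparameter_scales (X B N k m : R) : 1 <= X ->
    0 < B -> 2 <= N -> 1 <= k -> k <= N -> 1 <= m -> m <= N ->
  let b := B ^+ 2 / (X * N ^+ 4 * k ^+ 2 * m ^+ 2) in
  let sm := B ^+ 2 / (4 * X) / (N ^+ 2 * k) in
  [/\ B ^+ 2 / X / N ^+ 8 <= b, b <= sm,
     B ^+ 2 / (4 * X) / N ^+ 3 <= sm & sm <= B ^+ 2].
Proof.
move=> X1 B0 N2 k1 kN m1 mN b sm.
have B20 : 0 < B ^+ 2 by rewrite exprn_gt0.
have N0 : 0 < N by apply: lt_le_trans N2.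
have k0 : 0 < k by apply: lt_le_trans k1.
have m0 : 0 < m by apply: lt_le_trans m1.
have X0 : 0 < X by apply: lt_le_trans X1.
have Nge1 : 1 <= N by apply: le_trans N2; rewrite ler1n.
have BX : 0 < B ^+ 2 / X by exact: divr_gt0.
have BY : 0 < B ^+ 2 / (4 * X) by rewrite divr_gt0 ?mulr_gt0.
have bE : b = B ^+ 2 / X / (N ^+ 4 * (k ^+ 2 * m ^+ 2)).
  by rewrite /b -!mulrA invfM mulrA.
have N4 : 4 <= N ^+ 2.
  by rewrite (_ : 4 = 2 * 2) ?expr2 ?ler_pM// -natrM.
have km : k <= k ^+ 2 * m ^+ 2.
  rewrite -[leLHS]mulr1; apply: ler_pM; rewrite ?(ltW k0)//.
    by rewrite expr2 ler_peMl// ltW.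
  by rewrite exprn_ege1.
have NN i j : N ^+ (i + j) = N ^+ i * N ^+ j by rewrite exprD.
split.
- rewrite bE ler_pM2l// lef_pV2 ?posrE ?mulr_gt0 ?exprn_gt0//.
  rewrite (NN 4 4)%N ler_pM2l ?exprn_gt0// (NN 2 2)%N.
  by apply: ler_pM; rewrite ?exprn_ge0 ?lerXn2r ?nnegrE ?(ltW k0) ?(ltW m0) ?(ltW N0).
- rewrite bE /sm.
  have -> : B ^+ 2 / X / (N ^+ 4 * (k ^+ 2 * m ^+ 2)) =
      B ^+ 2 / (4 * X) * (4 / (N ^+ 4 * (k ^+ 2 * m ^+ 2))).
    by field; rewrite !gt_eqF.
  rewrite ler_pM2l// ler_pdivrMr ?mulr_gt0 ?exprn_gt0//.
  rewrite mulrC ler_pdivlMr ?mulr_gt0 ?exprn_gt0//.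
  rewrite (NN 2 2)%N -(mulrA (N ^+ 2) (N ^+ 2)) ler_pM ?mulr_ge0 ?exprn_ge0 ?(ltW N0) ?(ltW k0)//.
  by rewrite ler_wpM2l// exprn_ge0// ltW.
- rewrite /sm ler_pM2l// lef_pV2 ?posrE ?mulr_gt0 ?exprn_gt0//.
  by rewrite [leRHS]exprSr ler_pM2l ?exprn_gt0.
- rewrite /sm -mulrA ler_piMr ?(ltW B20)// -invfM invf_le1 ?mulr_gt0 ?exprn_gt0//.
  have : 1 <= N ^+ 2 * k by rewrite mulr_ege1// exprn_ege1.
  by apply: mulr_ege1; rewrite mulr_ege1// ler1n.
Qed.

Let entry_scaleE (B N e : R) : 0 < B -> 0 < N ->
  B / (8 * N) / B * (e / 2) = e / 16 / N.
Proof. by move=> B0 N0; field; rewrite !gt_eqF. Qed.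

(** Here the 512 of [b] pays off: 8 cancels the constant of the tail bound, 64 the square of the 8
    in tau. This leaves a failure probability 1 / (2 K) per entry. *)
Let column_scaleE (X B N k : R) : X = 8 * 64 -> 0 < B -> 0 < N -> 0 < k ->
  let sm := B ^+ 2 / (4 * X) / (N ^+ 2 * k) in
  8 * ((sm + sm) / (B / (8 * N)) ^+ 2) = (2 * k)^-1.
Proof. by move=> -> B0 N0 k0 /=; field; rewrite !gt_eqF. Qed.

Let half_onem (k : R) : k != 0 -> 1 - k * (2 * k)^-1 = 2^-1.
Proof. by move=> k0; field. Qed.

Let ball_radius (B N k n : R) : 0 < B -> 0 < N -> 0 < n -> k * n <= N ->
  k * (3 * B * (B / (8 * N))) <= B ^+ 2 / n.
Proof.
move=> B0 N0 n0 kn; rewrite ler_pdivlMr//.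
have -> : k * (3 * B * (B / (8 * N))) * n = B ^+ 2 * (3 / 8 * (k * n / N)).
  by field; rewrite gt_eqF.
rewrite ler_piMr ?sqr_ge0//.
have : k * n / N <= 1 by rewrite ler_pdivrMr// mul1r.
lra.
Qed.

Lemma factorization_prior_ball_ge (a B : R) : 0 < a -> 0 < B ->
  exists q : nat, forall (d1 d2 n K r : nat) (F : hyperfamily)
    (prior : probability 'M[R]_(d1, d2) R)
    (U : 'M[R]_(d1, K)) (V : 'M[R]_(d2, K)),
  let N : R := (n * d1 * d2)%:R in
  let b := B ^+ 2 / (512 * N ^+ 4 * K%:R ^+ 2 * (maxn d1 d2)%:R ^+ 2) in
  (1 < n * d1 * d2)%N -> (0 < K)%N -> (K <= minn d1 d2)%N ->
  (0 < r)%N -> (r <= K)%N -> low_rank_class r B U V ->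
  is_factorization_prior K (hyperprior F a b) prior ->
  ((N^-1 ^+ (q * (r * (d1 + d2))))%:E <=
    prior (entrywise_ball (U *m V^T) (B ^+ 2 / n%:R)))%E.
Proof.
move=> a0 B0; have B20 : 0 < B ^+ 2 by rewrite exprn_gt0.
have [X [XE X1 X8]] : exists X : R, [/\ X = 512, 1 <= X & X = 8 * 64].
  by exists 512; split; [by []|rewrite ler1n|rewrite -natrM].
rewrite -XE.
have X0 : 0 < X by apply: lt_le_trans X1.
have be0 : 0 < B ^+ 2 / X by rewrite divr_gt0.
have sg0 : 0 < B ^+ 2 / (4 * X) by rewrite divr_gt0 ?mulr_gt0.
have [q1 hq1] := hyperprior_ge_exprV a0 be0 sg0 B20.
have e16 : 0 < expR (- 2) / 16 :> R by rewrite divr_gt0 ?expR_gt0.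
have [q2 hq2] := exists_exprV_le e16.
(* [q1] is for the hyperprior masses, [q2] for the constant in each Gaussian window, and 2 for the
   width 1 / N of the window and for the bound 1 / N on [w ^+ K]. *)
exists (q1 + (q2 + 2))%N => d1 d2 n K r F prior U V N b N1 K0 Kd r0 rK.
move=> [UB VB Ur Vr] [d' [Om [Q [gamma [L [Rm [hier priorE]]]]]]].
have N2 : 2 <= N by rewrite ler_nat.
have N0 : 0 < N by apply: lt_le_trans N2.
have Nge1 : 1 <= N by apply: le_trans N2; rewrite ler1n.
have [n0 [d10 d20]] : (0 < n)%N /\ (0 < d1)%N /\ (0 < d2)%N.
  by move: (ltnW N1); rewrite !muln_gt0 => /andP[/andP[]].
have d1N : (d1 <= n * d1 * d2)%N.
  by rewrite mulnAC -[leqLHS]mul1n leq_mul// muln_gt0 n0.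
have d2N : (d2 <= n * d1 * d2)%N by rewrite -[leqLHS]mul1n leq_mul// muln_gt0 n0.
have Kd1 : (K <= d1)%N by rewrite (leq_trans Kd)// geq_minl.
pose k : R := K%:R; pose m : R := (maxn d1 d2)%:R.
have k1 : 1 <= k by rewrite ler1n.
have kN : k <= N by rewrite ler_nat (leq_trans Kd1).
have m1 : 1 <= m by rewrite ler1n leq_max d10.
have mN : m <= N by rewrite ler_nat geq_max d1N d2N.
have [beb bsm sgsm smB] := hyperparameter_scales X1 B0 N2 k1 kN m1 mN.
set sm := _ / (_ * k) in bsm sgsm smB.
have k0 : 0 < k by apply: lt_le_trans k1.
have sm0 : 0 < sm by apply: divr_gt0 => //; rewrite mulr_gt0 ?exprn_gt0.
pose tau := B / (8 * N).
have tau0 : 0 < tau by rewrite divr_gt0 ?mulr_gt0.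
have tauB : tau <= B.
  rewrite ler_pdivrMr ?mulr_gt0// ler_peMr ?(ltW B0)//.
  by rewrite mulr_ege1// ler1n.
pose s (l : 'I_K) := if (l < r)%N then B ^+ 2 else sm.
pose A l := `[s l, s l + s l]%classic.
pose I (u : R) := `[u - tau, u + tau]%classic.
pose w : R := 1 - (2 * k)^-1.
have w0 : 0 <= w.
  by rewrite subr_ge0 invf_le1 ?mulr_gt0// mulr_ege1// ler1n.
have NV0 : 0 <= N^-1 by rewrite invr_ge0 ltW.
have NV1 : N^-1 <= 1 by rewrite invf_le1.
pose v : R := N^-1 ^+ q2.+1.
have v0 : 0 <= v by rewrite exprn_ge0.
(* [w] is put on all columns, weakening the bound on the first [r], so that the product is simply
   v^r w^K. *)
pose g (l : 'I_K) := (if (l < r)%N then v else 1) * w.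
have g0 l : 0 <= g l by rewrite mulr_ge0//; case: ifP.
have IU (W : R) (l : 'I_K) (x : R) : `|W| <= B -> ((r <= l)%N -> W = 0) -> A l x ->
    ((g l)%:E <= normal_prob 0 (Num.sqrt x) (I W))%E.
  move=> WB Wr; rewrite /A /s /g /= in_itv/=; case: ltnP => [lr|rl] /andP[x1 x2].
    have x0 : 0 < x by apply: lt_le_trans x1.
    have sx : Num.sqrt x ^+ 2 = x by rewrite sqr_sqrtr// ltW.
    apply: le_trans (normal_prob_itv_ge B0 _ _ _ WB tau0 tauB).
    - rewrite lee_fin; apply: (@le_trans _ _ v).
        by rewrite ler_piMr// lerBlDr lerDl invr_ge0 mulr_ge0// ltW.
      rewrite entry_scaleE//.
      by rewrite /v exprSr ler_wpM2r// hq2.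
    - by rewrite sqrtr_gt0.
    - by rewrite sx.
    - by rewrite sx mulr_natl mulr2n.
  have x0 : 0 < x by apply: lt_le_trans x1.
  have sx : Num.sqrt x ^+ 2 = x by rewrite sqr_sqrtr// ltW.
  rewrite Wr// /I sub0r add0r mul1r.
  have sx0 : 0 < Num.sqrt x by rewrite sqrtr_gt0.
  apply: le_trans (normal_prob_itvNxx_ge sx0 tau0).
  rewrite lee_fin /w sx lerD2l lerN2.
  apply: (@le_trans _ _ (8 * ((sm + sm) / tau ^+ 2))).
    by rewrite ler_pM2l// ler_pM2r// invr_gt0 exprn_gt0.
  by rewrite column_scaleE.
have hierQ := factor_hierarchy_ge (A := A) (SL := fun i l => I (U i l))
  (SR := fun j l => I (V j l)) (p := N^-1 ^+ q1) hier _ _ _ _ g0.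
rewrite priorE; last exact: measurable_entrywise_ball.
set E := [set t | _].
set E' := [set t | _] in hierQ.
apply: (@le_trans _ _ (Q E')).
  apply: le_trans (hierQ _ _ _ _ _ _ _).
  (* Bernoulli gives 1 - K / (2 K) = 1/2, which is at least 1 / N. *)
  - have w2 : N^-1 <= w ^+ K.
      apply: (@le_trans _ _ 2^-1); first by rewrite lef_pV2// posrE.
      apply: le_trans (onem_exprn_ge K _ _); rewrite ?invr_ge0 ?invf_le1 ?mulr_gt0//.
      - by rewrite -/k half_onem ?gt_eqF.
      - by rewrite mulr_ge0// ltW.
      - by rewrite mulr_ege1// ler1n.
    have -> : \prod_(l < K) g l = v ^+ r * w ^+ K.
      by rewrite big_split/= prod_ltn// prodr_const card_ord.
    rewrite lee_fin; apply: (@le_trans _ _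
        ((v ^+ r * N^-1) ^+ (d1 + d2) * (N^-1 ^+ q1) ^+ K)); last first.
      rewrite ler_wpM2r ?exprn_ge0//.
      by rewrite lerXn2r ?nnegrE ?mulr_ge0 ?exprn_ge0// ler_wpM2l ?exprn_ge0.
    have -> : v ^+ r * N^-1 = N^-1 ^+ (q2.+1 * r).+1 by rewrite /v -exprM exprSr.
    rewrite -!exprM -exprD; apply: ler_wiXn2l => //.
    (* The K hyperprior masses fit the target exponent because K is at most d1. *)
    have Kdd : (K <= r * (d1 + d2))%N.
      by rewrite (leq_trans Kd1)// (leq_trans (leq_addr d2 d1))// leq_pmull.
    have rr : ((q2.+1 * r).+1 <= (q2 + 2) * r)%N by move: r0; clear; lia.
    rewrite mulnDl addnC leq_add// ?leq_mul2l ?Kdd ?orbT//.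
    by rewrite mulnA leq_mul2r rr orbT.
  - by move=> l; exact: measurable_itv.
  - by move=> i l; exact: measurable_itv.
  - by move=> j l; exact: measurable_itv.
  - by rewrite exprn_ge0.
  - have smA l : sm <= s l <= B ^+ 2 by rewrite /s; case: ifP; rewrite ?smB lexx.
    move=> l; have /andP[sml slB] := smA l.
    by apply: hq1; [|exact: beb|exact: le_trans sml|exact: le_trans sml|].
  - by move=> i l x; apply: IU => //; exact: Ur.
  - by move=> j l x; apply: IU => //; exact: Vr.
have mLU (i : 'I_d1) l : measurable_fun setT (fun t => L t i l).
  exact: (measurableT_comp (measurable_coord i l) (measurable_funPT L)).
have mRV (j : 'I_d2) l : measurable_fun setT (fun t => Rm t j l).
  exact: (measurableT_comp (measurable_coord j l) (measurable_funPT Rm)).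
have mpre f (C : set R) : measurable_fun setT f -> measurable C ->
    measurable (f @^-1` C : set Om).
  by move=> mf mC; rewrite -[X in measurable X]setTI; exact: mf.
have mE' : measurable E'.
  have -> : E' = (\bigcap_(l in [set: 'I_K]) (gamma l @^-1` A l)) `&`
      ((\bigcap_(i in [set: 'I_d1]) \bigcap_(l in [set: 'I_K])
          ((fun t => L t i l) @^-1` I (U i l))) `&`
       (\bigcap_(j in [set: 'I_d2]) \bigcap_(l in [set: 'I_K])
          ((fun t => Rm t j l) @^-1` I (V j l)))).
    apply/seteqP; split => t /=.
      by move=> [At Lt Rt]; split => [l _|]; [exact: At|split => i _ l _; [exact: Lt|exact: Rt]].
    by move=> [At [Lt Rt]]; split => [l|i l|j l]; [exact: At|exact: Lt|exact: Rt].
  apply: measurableI.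
    by apply: fin_bigcap_measurable => // l _; apply: mpre => //; exact: measurable_itv.
  apply: measurableI; apply: fin_bigcap_measurable => // i _;
    by apply: fin_bigcap_measurable => // l _; apply: mpre => //; exact: measurable_itv.
have mE : measurable E.
  have -> : E = \bigcap_(i in [set: 'I_d1]) \bigcap_(j in [set: 'I_d2])
      ((fun t => \sum_l L t i l * Rm t j l) @^-1`
         `[(U *m V^T) i j - B ^+ 2 / n%:R, (U *m V^T) i j + B ^+ 2 / n%:R]%classic).
    have LRE t i j : (L t *m (Rm t)^T) i j = \sum_l L t i l * Rm t j l.
      by rewrite mxE; apply: eq_bigr => l _; rewrite mxE.
    apply/seteqP; split => t /= Et i => [_ j _ /=|j].
      by have := Et i j; rewrite in_itv/= LRE ler_distl.
    by have := Et i Logic.I j Logic.I; rewrite /= in_itv/= LRE ler_distl.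
  apply: fin_bigcap_measurable => // i _; apply: fin_bigcap_measurable => // j _.
  apply: mpre; last exact: measurable_itv.
  by apply: measurable_sum => l; exact: measurable_funM.
apply: le_measure; rewrite ?inE//.
move=> t [_ LU RV] /= i j.
have in_I (W x : R) : I W x -> `|x - W| <= tau.
  by rewrite /I /= in_itv/= ler_distl.
have LU' i' l : `|L t i' l - U i' l| <= tau by apply: in_I; exact: LU.
have RV' j' l : `|Rm t j' l - V j' l| <= tau by apply: in_I; exact: RV.
apply: (le_trans (mulmxt_close tauB UB VB LU' RV' i j)).
apply: ball_radius => //; rewrite ?ltr0n//.
rewrite -natrM ler_nat -mulnA mulnC leq_mul2l (leq_trans Kd1) ?orbT//.
by rewrite leq_pmulr.
Qed.

End prior_mass.

(** * Choice of the constant and conclusion *)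

Theorem theorem2 (R : realType) (a B : R) (a_gt0 : 0 < a) (B_gt0 : 0 < B) :
  exists C : R, 0 < C /\
  forall (d1 d2 n K r : nat)
    (n_gt0 : (0 < n)%N) (K_gt0 : (0 < K)%N) (K_le : (K <= minn d1 d2)%N)
    (r_gt0 : (0 < r)%N) (r_le : (r <= K)%N)
    (alpha : R) (alpha_gt0 : 0 < alpha) (alpha_lt1 : alpha < 1)
    (Pi : 'I_d1 * 'I_d2 -> R) (Pi_pmf : is_pmf Pi)
    (U : 'M[R]_(d1, K)) (V : 'M[R]_(d2, K)) (UV : low_rank_class r B U V)
    (Mstar : 'M[R]_(d1, d2)) (Mstar_eq : Mstar = U *m V^T)
    (d : measure_display) (Omega : measurableType d) (P : probability Omega R)
    (X : 'I_n -> Omega -> obs d1 d2) (X_iid : iid_sample P X (PM Pi Mstar))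
    (F : hyperfamily) (pi : probability 'M[R]_(d1, d2) R),
  let eps := C * (r%:R * (d1 + d2)%:R * ln (n * d1 * d2)%:R / n%:R) in
  let b := B ^+ 2 / (512 * (n * d1 * d2)%:R ^+ 4 * K%:R ^+ 2
                     * (maxn d1 d2)%:R ^+ 2) in
  is_factorization_prior K (hyperprior F a b) pi ->
  (1 - 2%:E / (n%:R * eps)%:E <=
   P [set t | \int[fractional_posterior alpha pi (fun s => X s t)]_M
                (renyi alpha (PM Pi M) (PM Pi Mstar))%:E
              <= (2 * (alpha + 1) / (1 - alpha) * eps)%:E])%E.
Proof.
have [q hq] := factorization_prior_ball_ge a_gt0 B_gt0.
have ln20 : 0 < ln 2 :> R by rewrite ln_gt0 ?ltr1n.
(* The three summands ensure, in order, prior mass at least exp(- T), n delta = B^2 at most T, and T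
   at least 1. The last two use that r (d1 + d2) ln N is at least ln 2. *)
pose C : R := q%:R + B ^+ 2 / ln 2 + (ln 2)^-1.
have C0 : 0 < C.
  by rewrite ltr_wpDl ?invr_gt0// addr_ge0// divr_ge0 ?sqr_ge0 ?(ltW ln20).
exists C; split=> // d1 d2 n K r n_gt0 K_gt0 K_le r_gt0 r_le alpha alpha_gt0
  alpha_lt1 Pi Pi_pmf U V UV Mstar Mstar_eq d Omega P X X_iid F pi eps b hpi.
have d1_gt0 : (0 < d1)%N by rewrite (leq_trans K_gt0)// (leq_trans K_le)// geq_minl.
have d2_gt0 : (0 < d2)%N by rewrite (leq_trans K_gt0)// (leq_trans K_le)// geq_minr.
have nR0 : 0 < n%:R :> R by rewrite ltr0n.
set N : R := (n * d1 * d2)%:R in eps b hpi *.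
(* If N = 1 then eps = 0, the extended quotient 2 / 0 is +oo, and the lower bound is -oo. *)
have [N1|N1] := leqP (n * d1 * d2) 1.
  have NE : N = 1.
    rewrite /N (_ : n * d1 * d2 = 1)%N//; apply/eqP.
    by rewrite eqn_leq N1 !muln_gt0 n_gt0 d1_gt0.
  by rewrite /eps NE ln1 !(mulr0, mul0r) inve0 mulry gtr0_sg// mul1e leNye.
have N0 : 0 < N by rewrite ltr0n (ltnW N1).
have lnN : ln 2 <= ln N by rewrite ler_ln ?posrE// ler_nat.
pose T := n%:R * eps.
have TE : T = C * ((r * (d1 + d2))%:R * ln N).
  by rewrite /T /eps natrM; field; rewrite gt_eqF.
have rd1 : 1 <= (r * (d1 + d2))%:R :> R by rewrite ler1n muln_gt0 r_gt0 addn_gt0 d1_gt0.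
have ln2_le : ln 2 <= (r * (d1 + d2))%:R * ln N.
  by rewrite -[leLHS]mul1r ler_pM// ltW.
have T_ge c : 0 <= c -> c <= C -> c * ((r * (d1 + d2))%:R * ln N) <= T.
  by move=> c0 cC; rewrite TE ler_wpM2r// (le_trans (ltW ln20)).
have Cln : C * ln 2 <= T by rewrite TE ler_pM2l.
have T1 : 1 <= T.
  apply: le_trans Cln; rewrite /C mulrDl mulVf ?gt_eqF// lerDr.
  by rewrite mulr_ge0 ?addr_ge0 ?divr_ge0 ?sqr_ge0 ?(ltW ln20).
have TB : n%:R * (B ^+ 2 / n%:R) <= T.
  rewrite mulrC divfK ?gt_eqF//; apply: le_trans Cln.
  rewrite /C !mulrDl divfK ?gt_eqF// mulVf ?gt_eqF//.
  by rewrite -addrA addrCA lerDl addr_ge0// mulr_ge0// ltW.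
have priorT : ((expR (- T))%:E <= pi (entrywise_ball Mstar (B ^+ 2 / n%:R)))%E.
  rewrite Mstar_eq; apply: le_trans (hq _ _ _ _ _ _ _ _ _ N1 K_gt0 K_le r_gt0 r_le UV hpi).
  rewrite lee_fin -/N exprVn expRN lef_pV2 ?posrE ?expR_gt0 ?exprn_gt0//.
  rewrite -[in leLHS](lnK (x := N)) ?posrE// -expRM_natl ler_expR natrM -mulrA.
  apply: T_ge => //; rewrite /C -addrA lerDl addr_ge0 ?invr_ge0 ?(ltW ln20)//.
  by rewrite divr_ge0 ?sqr_ge0 ?(ltW ln20).
have T0 : 0 < T by exact: lt_le_trans T1.
have := fractional_posterior_contraction alpha_gt0 alpha_lt1 Pi_pmf n_gt0 X_iid T1 TB priorT.
have -> : T / n%:R = eps by rewrite /T mulrC mulKf// gt_eqF.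
(* The contraction theorem gives 1 - 1 / T, which exceeds 1 - 2 / T. *)
apply: le_trans; rewrite -/T inver gt_eqF// -EFinM leeB// lee_fin.
by rewrite ler_peMl ?invr_ge0 ?(ltW T0)// ler1n.
Qed.
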